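(* $(\text{GLAMoUr},\multimap_{\mathtt{uf}},\equiv,\underline{\,\cdot\,})$ is a reflective explicit distillery. In particular, for every reachable state $s$ of the GLAMoUr machine: (1) (Commutative) if $s\leadsto_{c_i}s'$ with $i\in\{1,2,3,4,5\}$ then $\underline{s}=\underline{s'}$; (2) (Multiplicative) if $s\leadsto_{\mathtt{um}}s'$ then $\underline{s}\multimap_{\mathtt{um}}\equiv\underline{s'}$; (3) (Exponential) if $s\leadsto_{\mathtt{ue}}s'$ then $\underline{s}\multimap_{\mathtt{ue}}\underline{s'}$.
   Context: **Terms.** Terms with explicit substitutions (ES): $t,u,w::=x\mid a\mid\lambda x.t\mid tu\mid t[x\leftarrow u]$, where $x$ ranges over variables, $a$ over a separate set of symbols (constants, never bound), and $t[x\leftarrow u]$ binds $x$ in $t$; terms are up to $\alpha$. $\lambda$-terms are terms without ES; closed means without free variables. On $\lambda$-terms: values $v::=\lambda x.t$, fireballs $f::=v\mid A$, inerts $A::=a\mid Af$. (In terms with ES, values are also the abstractions.) Unfolding: $x{\downarrow}=x$, $a{\downarrow}=a$, $(tu){\downarrow}=t{\downarrow}u{\downarrow}$, $(\lambda x.t){\downarrow}=\lambda x.t{\downarrow}$, $t[x\leftarrow u]{\downarrow}=t{\downarrow}\{x\leftarrow u{\downarrow}\}$, where $\{x\leftarrow u\}$ is capture-avoiding substitution. Contexts (plugging may capture): substitution $L::=\langle\cdot\rangle\mid L[x\leftarrow t]$; shallow $S::=\langle\cdot\rangle\mid St\mid tS\mid S[x\leftarrow t]$; weak $W::=\langle\cdot\rangle\mid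 tW\mid Wt\mid W[x\leftarrow t]\mid t[x\leftarrow W]$. Substitution $S\{x\leftarrow u\}$ on a context leaves the hole unchanged and acts on all its subterms. Relative unfolding: $t{\downarrow}_{\langle\cdot\rangle}=t{\downarrow}$, $t{\downarrow}_{uS}=t{\downarrow}_{Su}=t{\downarrow}_S$, $t{\downarrow}_{S[x\leftarrow u]}=t{\downarrow}_S\{x\leftarrow u{\downarrow}\}$. **Structural equivalence** $\equiv$ (on terms): least equivalence closed under weak contexts containing $t[x\leftarrow u][y\leftarrow w]\equiv t[y\leftarrow w][x\leftarrow u]$ if $y\notin fv(u)$, $x\notin fv(w)$; $(tw)[x\leftarrow u]\equiv t\,(w[x\leftarrow u])$ if $x\notin fv(t)$; $(tw)[x\leftarrow u]\equiv (t[x\leftarrow u])\,w$ if $x\notin fv(w)$; $t[x\leftarrow u][y\leftarrow w]\equiv t[x\leftarrow u[y\leftarrow w]]$ if $y\notin fv(t)$. **Useful Fireball Calculus.** Evaluable shallow contexts: $\langle\cdot\rangle$; $St$ if $S$ is evaluable and $t{\downarrow}$ is a fireball; $tS$ if $S$ is evaluable; $S[x\leftarrow t]$ if $t{\downarrow}$ is a fireball and $S\{x\leftarrow t{\downarrow}\}$ is evaluable. $S$ is applicative if $S=S'\langle L\,u\rangle$ (hole of $S$ = hole of $L$); useful = evaluable and applicative. The strategy on terms is $\multimap_{\mathtt{uf}}=\multimap_{\mathtt{um}}\cup\multimap_{\mathtt{ue}}$ (up to $\alpha$; the displayed $x$ is bound by the displayed ES; moving $L$ outwards captures nothing): $S\langle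 L\langle\lambda x.t\rangle u\rangle\multimap_{\mathtt{um}}S\langle L\langle t[x\leftarrow u]\rangle\rangle$ if $S\langle L\,u\rangle$ is useful; $S\langle S'\langle x\rangle[x\leftarrow L\langle u\rangle]\rangle\multimap_{\mathtt{ue}}S\langle L\langle S'\langle u\rangle[x\leftarrow u]\rangle\rangle$ if $S\langle S'[x\leftarrow L\langle u\rangle]\rangle$ is useful, $u$ is not of the form $u'[y\leftarrow w]$, and $u{\downarrow}_{S\langle L\rangle}$ is a value. **GLAMoUr machine.** Codes $\bar t,\bar u$ are $\lambda$-terms not taken up to $\alpha$. Labels $l::=\mathsf v\mid\mathsf A$. Stack items $\phi::=\bar t\mid(\bar t,\pi)$; stacks $\pi::=\epsilon\mid\phi^l:\pi$; dumps $D::=\epsilon\mid D:(\bar t,\pi)$; environments $E::=\epsilon\mid[x\leftarrow\phi^l]:E$ (written by juxtaposition, $E_1[x\leftarrow\phi^l]E_2$). States are $(D,\bar t,\pi,E)$. Initial states are $(\epsilon,\bar t,\epsilon,\epsilon)$ with $\bar t$ a well-named (all bound names distinct) code of a closed $\lambda$-term; reachable states are those obtained from initial ones by transitions. Transitions: - $(D,\bar t\bar u,\pi,E)\leadsto_{c_1}(D:(\bar t,\pi),\bar u,\epsilon,E)$ - $(D,\lambda x.\bar t,\phi^l:\pi,E)\leadsto_{\mathtt{um}}(D,\bar t,\pi,[x\leftarrow\phi^l]E)$ - $(D:(\bar t,\pi),\lambda x.\bar u,\epsilon,E)\leadsto_{c_2}(D,\bar t,(\lambda x.\bar u)^{\mathsf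 v}:\pi,E)$ - $(D:(\bar t,\pi),a,\pi',E)\leadsto_{c_3}(D,\bar t,(a,\pi')^{\mathsf A}:\pi,E)$ - $(D:(\bar t,\pi),x,\pi',E)\leadsto_{c_4}(D,\bar t,(x,\pi')^{\mathsf A}:\pi,E)$ if $E=E_1[x\leftarrow\phi^{\mathsf A}]E_2$ - $(D:(\bar t,\pi),x,\epsilon,E)\leadsto_{c_5}(D,\bar t,x^{\mathsf v}:\pi,E)$ if $E=E_1[x\leftarrow\bar u^{\mathsf v}]E_2$ - $(D,x,\phi^l:\pi,E)\leadsto_{\mathtt{ue}}(D,\bar u^{\alpha},\phi^l:\pi,E)$ if $E=E_1[x\leftarrow\bar u^{\mathsf v}]E_2$, where $\bar u^\alpha$ is any code $\alpha$-equivalent to $\bar u$ that preserves well-naming of the machine (the choice of fresh names is considered irrelevant for determinism). Decoding (labels ignored): $\underline\epsilon=\langle\cdot\rangle$; $\underline{\phi:\pi}=\underline\pi\langle\langle\cdot\rangle\underline\phi\rangle$; a stack item that is a code decodes to itself, and $\underline{(\bar t,\pi)}=\underline\pi\langle\bar t\rangle$ for a stack item that is a pair; $\underline{D:(\bar t,\pi)}=\underline D\langle\underline\pi\langle\bar t\langle\cdot\rangle\rangle\rangle$; $\underline{[x\leftarrow\phi]:E}=\underline E\langle\langle\cdot\rangle[x\leftarrow\underline\phi]\rangle$; $\underline{(D,\bar t,\pi,E)}=\underline E\langle\underline D\langle\underline\pi\langle\bar t\rangle\rangle\rangle$. **Distilleries.** $(M,\multimap,\equiv,\underline{\,\cdot\,})$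 is a distillery if: $M$ is a machine with a deterministic labelled transition system on states, a class of initial states in bijection with closed $\lambda$-terms, and transitions partitioned into principal and commutative; $\multimap$ is a deterministic strategy on terms; $\equiv$ is an equivalence on terms that is a strong bisimulation w.r.t. $\multimap$ preserving the kind of rule (if $t\equiv u$ and $t\multimap_{\mathtt x}t'$ then there is $u'$ with $u\multimap_{\mathtt x}u'$ and $t'\equiv u'$); and $\underline{\,\cdot\,}$ maps states to terms so that, on reachable states, $s\leadsto s'$ implies $\underline s\multimap\equiv\underline{s'}$ for principal transitions and $\underline s\equiv\underline{s'}$ for commutative ones. It is reflective if on reachable states commutative transitions terminate and, whenever $\underline s$ is $\multimap$-reducible, $s$ is not final (some transition applies). It is explicit if principal transitions are partitioned into multiplicative and exponential ones, as for the strategy, and these decode to multiplicative, resp. exponential, $\multimap$-steps followed by $\equiv$. For the GLAMoUr, $c_1,\dots,c_5$ are commutative, $\mathtt{um}$ is multiplicative and $\mathtt{ue}$ is exponential.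
   Formalization: Strong bisimulation of ≡ is required only on terms obtained from λ-terms by the strategy and ≡; over all terms with ES it fails: (λx.x)(a[y←Ω]) has a um-step but the equivalent ((λx.x)a)[y←Ω] has none. *)

(* Defs.v *)
From Stdlib Require Import List Arith RelationClasses.
Import ListNotations.
Set Implicit Arguments.

(** * Terms with explicit substitutions, up to alpha *)

(** De Bruijn representation, so that alpha-equivalence is Leibniz equality:
    in [Es t u], i.e. t[x<-u], index 0 of [t] is the bound variable x.  [K] is
    the set of symbols; symbols are never bound. *)
Inductive term (K : Type) : Type :=
| Var (n : nat)
| Cst (a : K)
| Lam (t : term K)
| App (t u : term K)
| Es (t u : term K).

Arguments Var {K} n.
Arguments Cst {K} a.

Definition upr (r : nat -> nat) (n : nat) : nat :=
  match n with 0 => 0 | S m => S (r m) end.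

Fixpoint ren {K : Type} (r : nat -> nat) (t : term K) : term K :=
  match t with
  | Var n => Var (r n)
  | Cst a => Cst a
  | Lam t => Lam (ren (upr r) t)
  | App t u => App (ren r t) (ren r u)
  | Es t u => Es (ren (upr r) t) (ren r u)
  end.

Definition ups {K : Type} (s : nat -> term K) (n : nat) : term K :=
  match n with 0 => Var 0 | S m => ren S (s m) end.

Fixpoint sub {K : Type} (s : nat -> term K) (t : term K) : term K :=
  match t with
  | Var n => s n
  | Cst a => Cst a
  | Lam t => Lam (sub (ups s) t)
  | App t u => App (sub s t) (sub s u)
  | Es t u => Es (sub (ups s) t) (sub s u)
  end.

(** [sub (single u) t] is t{x<-u}, where x is index 0 of [t]. *)
Definition single {K : Type} (u : term K) (n : nat) : term K :=
  match n with 0 => u | S m => Var m end.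

Fixpoint unfold {K : Type} (t : term K) : term K :=
  match t with
  | Var n => Var n
  | Cst a => Cst a
  | Lam t => Lam (unfold t)
  | App t u => App (unfold t) (unfold u)
  | Es t u => sub (single (unfold u)) (unfold t)
  end.

Fixpoint lambda_term {K : Type} (t : term K) : Prop :=
  match t with
  | Var _ | Cst _ => True
  | Lam t => lambda_term t
  | App t u => lambda_term t /\ lambda_term u
  | Es _ _ => False
  end.

Fixpoint closed_at {K : Type} (n : nat) (t : term K) : Prop :=
  match t with
  | Var x => x < n
  | Cst _ => True
  | Lam t => closed_at (S n) t
  | App t u => closed_at n t /\ closed_at n u
  | Es t u => closed_at (S n) t /\ closed_at n u
  end.

Definition closed {K : Type} (t : term K) : Prop := closed_at 0 t.

Definition is_es {K : Type} (t : term K) : Prop := exists u w, t = Es u w.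

(** [value], [inert] and [fireball] classify lambda-terms: below they are only
    applied to unfoldings, which contain no explicit substitution. *)
Definition value {K : Type} (t : term K) : Prop := exists b, t = Lam b.

Inductive inert {K : Type} : term K -> Prop :=
| inert_cst a : inert (Cst a)
| inert_app t u : inert t -> fireball u -> inert (App t u)
with fireball {K : Type} : term K -> Prop :=
| fireball_value t : value t -> fireball t
| fireball_inert t : inert t -> fireball t.

(** * Contexts *)

Inductive lctx (K : Type) : Type :=
| LHole
| LEs (L : lctx K) (t : term K).

Inductive sctx (K : Type) : Type :=
| SHole
| SAppL (s : sctx K) (t : term K)
| SAppR (t : term K) (s : sctx K)
| SEs (s : sctx K) (t : term K).

Inductive wctx (K : Type) : Type :=
| WHole
| WAppL (w : wctx K) (t : term K)
| WAppR (t : term K) (w : wctx K)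
| WEsL (w : wctx K) (t : term K)
| WEsR (t : term K) (w : wctx K).

Arguments LHole {K}.
Arguments SHole {K}.
Arguments WHole {K}.

Fixpoint lctx_sctx {K : Type} (L : lctx K) : sctx K :=
  match L with
  | LHole => SHole
  | LEs L t => SEs (lctx_sctx L) t
  end.

Coercion lctx_sctx : lctx >-> sctx.

(** Plugging does not shift the plugged term: the binders of the context
    capture its free variables. *)
Fixpoint plug {K : Type} (C : sctx K) (t : term K) : term K :=
  match C with
  | SHole => t
  | SAppL C u => App (plug C t) u
  | SAppR u C => App u (plug C t)
  | SEs C u => Es (plug C t) u
  end.

Fixpoint wplug {K : Type} (C : wctx K) (t : term K) : term K :=
  match C with
  | WHole => t
  | WAppL C u => App (wplug C t) u
  | WAppR u C => App u (wplug C t)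
  | WEsL C u => Es (wplug C t) u
  | WEsR u C => Es u (wplug C t)
  end.

Fixpoint comp {K : Type} (C C' : sctx K) : sctx K :=
  match C with
  | SHole => C'
  | SAppL C u => SAppL (comp C C') u
  | SAppR u C => SAppR u (comp C C')
  | SEs C u => SEs (comp C C') u
  end.

(** Number of binders above the hole. *)
Fixpoint depth {K : Type} (C : sctx K) : nat :=
  match C with
  | SHole => 0
  | SAppL C _ | SAppR _ C => depth C
  | SEs C _ => S (depth C)
  end.

Fixpoint ren_ctx {K : Type} (r : nat -> nat) (C : sctx K) : sctx K :=
  match C with
  | SHole => SHole
  | SAppL C u => SAppL (ren_ctx r C) (ren r u)
  | SAppR u C => SAppR (ren r u) (ren_ctx r C)
  | SEs C u => SEs (ren_ctx (upr r) C) (ren r u)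
  end.

Fixpoint sub_ctx {K : Type} (s : nat -> term K) (C : sctx K) : sctx K :=
  match C with
  | SHole => SHole
  | SAppL C u => SAppL (sub_ctx s C) (sub s u)
  | SAppR u C => SAppR (sub s u) (sub_ctx s C)
  | SEs C u => SEs (sub_ctx (ups s) C) (sub s u)
  end.

Fixpoint unfold_in {K : Type} (t : term K) (C : sctx K) : term K :=
  match C with
  | SHole => unfold t
  | SAppL C _ | SAppR _ C => unfold_in t C
  | SEs C u => sub (single (unfold u)) (unfold_in t C)
  end.

(** * Structural equivalence *)

Definition swap01 (n : nat) : nat :=
  match n with 0 => 1 | 1 => 0 | _ => n end.

(** A side condition x \notin fv(t) becomes the requirement that [t] be a
    renaming that skips the index of x. *)
Inductive equiv_ax {K : Type} : term K -> term K -> Prop :=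
| ax_com t u w :
    equiv_ax (Es (Es t (ren S u)) w) (Es (Es (ren swap01 t) (ren S w)) u)
| ax_appr t w u :
    equiv_ax (Es (App (ren S t) w) u) (App t (Es w u))
| ax_appl t w u :
    equiv_ax (Es (App t (ren S w)) u) (App (Es t u) w)
| ax_nest t u w :
    equiv_ax (Es (Es (ren (upr S) t) u) w) (Es t (Es u w)).

Inductive equiv {K : Type} : term K -> term K -> Prop :=
| equiv_in_ax t u : equiv_ax t u -> equiv t u
| equiv_refl t : equiv t t
| equiv_sym t u : equiv t u -> equiv u t
| equiv_trans t u w : equiv t u -> equiv u w -> equiv t w
| equiv_ctx (W : wctx K) t u : equiv t u -> equiv (wplug W t) (wplug W u).

(** * The Useful Fireball Calculus *)

Inductive evaluable {K : Type} : sctx K -> Prop :=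
| ev_hole : evaluable SHole
| ev_appl C t : evaluable C -> fireball (unfold t) -> evaluable (SAppL C t)
| ev_appr t C : evaluable C -> evaluable (SAppR t C)
| ev_es C t :
    fireball (unfold t) -> evaluable (sub_ctx (single (unfold t)) C) ->
    evaluable (SEs C t).

Definition applicative {K : Type} (C : sctx K) : Prop :=
  exists (C' : sctx K) (L : lctx K) (u : term K), C = comp C' (SAppL L u).

Definition useful {K : Type} (C : sctx K) : Prop :=
  evaluable C /\ applicative C.

(** The argument [u] enters the scope of [L], hence the shift; this is the
    condition that moving [L] outwards captures nothing. *)
Inductive um {K : Type} : term K -> term K -> Prop :=
| um_step (C : sctx K) (L : lctx K) (t u : term K) :
    useful (comp C (SAppL L u)) ->
    um (plug C (App (plug L (Lam t)) u))
       (plug C (plug L (Es t (ren (Nat.add (depth L)) u)))).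

(** The variable [Var (depth C')] plugged in [C'] is the one bound by the
    displayed explicit substitution.  In the reduct, [C'] moves under the
    binders of [L], and the copy of [u] in the hole of [C'] moves under the
    displayed binder and those of [C']. *)
Inductive ue {K : Type} : term K -> term K -> Prop :=
| ue_step (C C' : sctx K) (L : lctx K) (u : term K) :
    useful (comp C (SEs C' (plug L u))) ->
    ~ is_es u ->
    value (unfold_in u (comp C L)) ->
    ue (plug C (Es (plug C' (Var (depth C'))) (plug L u)))
       (plug C (plug L
          (Es (plug (ren_ctx (upr (Nat.add (depth L))) C')
                    (ren (Nat.add (S (depth C'))) u))
              u))).

Inductive rule : Type := multiplicative | exponential.

Definition uf {K : Type} (r : rule) : term K -> term K -> Prop :=
  match r with multiplicative => um | exponential => ue end.

(** * The GLAMoUr machine *)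

Definition name : Type := nat.

(** Lambda-terms with named variables, not up to alpha. *)
Inductive code (K : Type) : Type :=
| CVar (x : name)
| CCst (a : K)
| CLam (x : name) (t : code K)
| CApp (t u : code K).

Arguments CVar {K} x.
Arguments CCst {K} a.

Fixpoint index (x : name) (G : list name) : nat :=
  match G with
  | [] => x
  | y :: G => if Nat.eqb x y then 0 else S (index x G)
  end.

(** The lambda-term (up to alpha) denoted by a code in the scope [G]; a name x
    outside [G] becomes the dangling index [length G + x]. *)
Fixpoint nameless {K : Type} (G : list name) (t : code K) : term K :=
  match t with
  | CVar x => Var (index x G)
  | CCst a => Cst a
  | CLam x t => Lam (nameless (x :: G) t)
  | CApp t u => App (nameless G t) (nameless G u)
  end.

Definition code_alpha {K : Type} (t u : code K) : Prop :=
  nameless [] t = nameless [] u.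

Fixpoint binders {K : Type} (t : code K) : list name :=
  match t with
  | CVar _ | CCst _ => []
  | CLam x t => x :: binders t
  | CApp t u => binders t ++ binders u
  end.

Inductive tag : Type := tagV | tagA.

(** The machine components are generic in the type [C] of the code they carry:
    [code K] for the machine, [term K] for states up to renaming. *)
Inductive item (C : Type) : Type :=
| ICode (t : C)
| IPair (t : C) (p : stack C)
with stack (C : Type) : Type :=
| SNil
| SCons (phi : item C) (l : tag) (p : stack C).

Arguments SNil {C}.

(** D:(t,pi) is [(t, pi) :: D]. *)
Definition dump (C : Type) : Type := list (C * stack C).

Definition env (K : Type) : Type := list (name * (item (code K) * tag)).

Definition dom {K : Type} (E : env K) : list name := map fst E.

Record gstate (K : Type) : Type := St {
  st_dump : dump (code K);
  st_code : code K;
  st_stack : stack (code K);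
  st_env : env K }.

Fixpoint item_binders {K : Type} (phi : item (code K)) : list name :=
  match phi with
  | ICode t => binders t
  | IPair t p => binders t ++ stack_binders p
  end
with stack_binders {K : Type} (p : stack (code K)) : list name :=
  match p with
  | SNil => []
  | SCons phi _ p => item_binders phi ++ stack_binders p
  end.

Definition state_binders {K : Type} (s : gstate K) : list name :=
  flat_map (fun c => binders (fst c) ++ stack_binders (snd c)) (st_dump s)
  ++ binders (st_code s)
  ++ stack_binders (st_stack s)
  ++ flat_map (fun b => fst b :: item_binders (fst (snd b))) (st_env s).

Definition well_named {K : Type} (s : gstate K) : Prop :=
  NoDup (state_binders s).

(** E = E1 [x<-phi^l] E2, where the displayed entry is the one binding x. *)
Definition bound_to {K : Type}
    (E : env K) (x : name) (phi : item (code K)) (l : tag) : Prop :=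
  exists E1 E2, E = E1 ++ (x, (phi, l)) :: E2 /\ ~ In x (dom E1).

Inductive glabel : Type := c1 | c2 | c3 | c4 | c5 | lum | lue.

Inductive gstep {K : Type} : glabel -> gstate K -> gstate K -> Prop :=
| step_c1 D t u p E :
    gstep c1 (St D (CApp t u) p E) (St ((t, p) :: D) u SNil E)
| step_um D x t phi l p E :
    gstep lum (St D (CLam x t) (SCons phi l p) E)
              (St D t p ((x, (phi, l)) :: E))
| step_c2 D t p x u E :
    gstep c2 (St ((t, p) :: D) (CLam x u) SNil E)
             (St D t (SCons (ICode (CLam x u)) tagV p) E)
| step_c3 D t p a p' E :
    gstep c3 (St ((t, p) :: D) (CCst a) p' E)
             (St D t (SCons (IPair (CCst a) p') tagA p) E)
| step_c4 D t p x p' E phi :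
    bound_to E x phi tagA ->
    gstep c4 (St ((t, p) :: D) (CVar x) p' E)
             (St D t (SCons (IPair (CVar x) p') tagA p) E)
| step_c5 D t p x E u :
    bound_to E x (ICode u) tagV ->
    gstep c5 (St ((t, p) :: D) (CVar x) SNil E)
             (St D t (SCons (ICode (CVar x)) tagV p) E)
| step_ue D x phi l p E u u' :
    bound_to E x (ICode u) tagV ->
    code_alpha u u' ->
    well_named (St D u' (SCons phi l p) E) ->
    gstep lue (St D (CVar x) (SCons phi l p) E)
              (St D u' (SCons phi l p) E).

Definition ginitial {K : Type} (s : gstate K) : Prop :=
  exists t : code K,
    s = St [] t SNil [] /\ NoDup (binders t) /\ closed (nameless [] t).

(** ** States up to renaming of bound names *)

Fixpoint map_item {C C' : Type} (f : C -> C') (phi : item C) : item C' :=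
  match phi with
  | ICode t => ICode (f t)
  | IPair t p => IPair (f t) (map_stack f p)
  end
with map_stack {C C' : Type} (f : C -> C') (p : stack C) : stack C' :=
  match p with
  | SNil => SNil
  | SCons phi l p => SCons (map_item f phi) l (map_stack f p)
  end.

Definition map_dump {C C' : Type} (f : C -> C') (D : dump C) : dump C' :=
  map (fun c => (f (fst c), map_stack f (snd c))) D.

(** [x<-phi^l]:E binds x in everything to the left of the entry, and in the
    other components of the state, but not in E. *)
Fixpoint nameless_env {K : Type} (E : env K) : list (item (term K) * tag) :=
  match E with
  | [] => []
  | (_, (phi, l)) :: E =>
      (map_item (nameless (dom E)) phi, l) :: nameless_env E
  end.

Record nstate (K : Type) : Type := NSt {
  nst_dump : dump (term K);
  nst_term : term K;
  nst_stack : stack (term K);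
  nst_env : list (item (term K) * tag) }.

Definition nameless_state {K : Type} (s : gstate K) : nstate K :=
  let f := nameless (dom (st_env s)) in
  NSt (map_dump f (st_dump s)) (f (st_code s))
      (map_stack f (st_stack s)) (nameless_env (st_env s)).

Definition state_alpha {K : Type} (s s' : gstate K) : Prop :=
  nameless_state s = nameless_state s'.

(** ** Decoding *)

(** The decodings of stacks, dumps and environments are contexts; they are
    given here by their plugging functions. *)
Fixpoint decode_item {K : Type} (phi : item (term K)) : term K :=
  match phi with
  | ICode t => t
  | IPair t p => decode_stack p t
  end
with decode_stack {K : Type} (p : stack (term K)) (t : term K) : term K :=
  match p with
  | SNil => t
  | SCons phi _ p => decode_stack p (App t (decode_item phi))
  end.

Fixpoint decode_dump {K : Type} (D : dump (term K)) (t : term K) : term K :=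
  match D with
  | [] => t
  | (u, p) :: D => decode_dump D (decode_stack p (App u t))
  end.

Fixpoint decode_env {K : Type}
    (E : list (item (term K) * tag)) (t : term K) : term K :=
  match E with
  | [] => t
  | (phi, _) :: E => decode_env E (Es t (decode_item phi))
  end.

Definition decode {K : Type} (s : gstate K) : term K :=
  let n := nameless_state s in
  decode_env (nst_env n)
    (decode_dump (nst_dump n) (decode_stack (nst_stack n) (nst_term n))).

(** * Distilleries *)

(** [state_eq] identifies states that differ by the choice of bound names;
    [kind l] is [None] for a commutative transition and [Some r] for a
    principal one. *)
Record machine : Type := Machine {
  state : Type;
  label : Type;
  step : label -> state -> state -> Prop;
  initial : state -> Prop;
  state_eq : state -> state -> Prop;
  kind : label -> option rule }.

Inductive reachable (M : machine) : state M -> Prop :=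
| reach_init s : initial M s -> reachable M s
| reach_step l s s' : reachable M s -> step M l s s' -> reachable M s'.

(** The terms obtained from lambda-terms by [red] and [eqv]. *)
Inductive generated {K : Type}
    (red : rule -> term K -> term K -> Prop) (eqv : term K -> term K -> Prop)
    : term K -> Prop :=
| gen_lambda t : lambda_term t -> generated red eqv t
| gen_red r t u : generated red eqv t -> red r t u -> generated red eqv u
| gen_eqv t u : generated red eqv t -> eqv t u -> generated red eqv u.

(** The bisimulation property is required on generated terms only.  It fails
    for arbitrary terms: with w not unfolding to a fireball,
    (\x.x)(a[y<-w]) is um-reducible, because a[y<-w] unfolds to a, whereas the
    equivalent term ((\x.x)a)[y<-w] is not.  In generated terms, the bodies of
    weak explicit substitutions always unfold to fireballs. *)
Record distillery {K : Type} (M : machine)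
    (red : rule -> term K -> term K -> Prop) (eqv : term K -> term K -> Prop)
    (dec : state M -> term K) : Prop := {
  state_eq_equivalence : Equivalence (state_eq M);
  step_deterministic : forall l1 l2 s s1 s2,
    step M l1 s s1 -> step M l2 s s2 -> l1 = l2 /\ state_eq M s1 s2;
  step_names_irrelevant : forall l s t s',
    reachable M s -> reachable M t -> state_eq M s t -> step M l s s' ->
    exists t', step M l t t' /\ state_eq M s' t';
  dec_state_eq : forall s t, state_eq M s t -> dec s = dec t;
  (* decoding is a bijection from initial states, up to the choice of bound
     names, to closed lambda-terms *)
  initial_lambda : forall s,
    initial M s -> lambda_term (dec s) /\ closed (dec s);
  initial_injective : forall s t,
    initial M s -> initial M t -> dec s = dec t -> state_eq M s t;
  initial_surjective : forall t,
    lambda_term t -> closed t -> exists s, initial M s /\ dec s = t;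
  red_deterministic : forall r1 r2 t t1 t2,
    red r1 t t1 -> red r2 t t2 -> t1 = t2;
  eqv_equivalence : Equivalence eqv;
  eqv_strong_bisimulation : forall r t u t',
    generated red eqv t -> eqv t u -> red r t t' ->
    exists u', red r u u' /\ eqv t' u';
  principal_simulation : forall l r s s',
    reachable M s -> step M l s s' -> kind M l = Some r ->
    exists r' u, red r' (dec s) u /\ eqv u (dec s');
  commutative_simulation : forall l s s',
    reachable M s -> step M l s s' -> kind M l = None ->
    eqv (dec s) (dec s') }.

Definition commutative_step (M : machine) (s s' : state M) : Prop :=
  exists l, kind M l = None /\ step M l s s'.

Record reflective {K : Type} (M : machine)
    (red : rule -> term K -> term K -> Prop) (dec : state M -> term K)
    : Prop := {
  commutative_termination : forall s,
    reachable M s -> Acc (fun s2 s1 => commutative_step M s1 s2) s;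
  progress : forall s,
    reachable M s -> (exists r u, red r (dec s) u) ->
    exists l s', step M l s s' }.

Definition explicit {K : Type} (M : machine)
    (red : rule -> term K -> term K -> Prop) (eqv : term K -> term K -> Prop)
    (dec : state M -> term K) : Prop :=
  forall l r s s',
    reachable M s -> step M l s s' -> kind M l = Some r ->
    exists u, red r (dec s) u /\ eqv u (dec s').

Definition reflective_explicit_distillery {K : Type} (M : machine)
    (red : rule -> term K -> term K -> Prop) (eqv : term K -> term K -> Prop)
    (dec : state M -> term K) : Prop :=
  distillery M red eqv dec /\ reflective M red dec /\ explicit M red eqv dec.

Definition gkind (l : glabel) : option rule :=
  match l with
  | c1 | c2 | c3 | c4 | c5 => None
  | lum => Some multiplicative
  | lue => Some exponential
  end.

Definition glamour (K : Type) : machine :=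
  {| state := gstate K;
     label := glabel;
     step := @gstep K;
     initial := @ginitial K;
     state_eq := @state_alpha K;
     kind := gkind |}.

(* Main.v *)
(** Both parts of the theorem go through a presentation of the calculus without
    global contexts: [redS r b s t t'] reduces [t] under an ambient substitution
    [s], which holds the unfoldings of the surrounding explicit substitutions,
    with a flag [b] telling whether [t] is applied.  The unfolding of a reducible
    term is never a fireball (never inert if the term is applied); this excludes
    reductions to the left of a reducible argument, hence determinism, and
    makes final states irreducible.

    Strong bisimulation relies on the invariant [fireball_es]: bodies of weak
    explicit substitutions unfold to fireballs, so that [ev] does not depend on
    where the explicit substitutions are placed.  Each axiom of the structural
    equivalence is then pushed through the redexes [beta] and [dup], and through
    the position of the variable to be replaced.

    The machine is simulated by a deterministic one on de Bruijn states.
    Well-naming makes the two agree, and the labels certify that the items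
    unfold to values or inerts, so that the decoded contexts are useful. *)

Require Import Defs.
From Stdlib Require Import List Arith Lia RelationClasses Permutation.
Import ListNotations.
Set Implicit Arguments.

(** Two features of the given rules resist induction on contexts. Evaluability of [S[x<-t]] is
    evaluability of [S] with the unfolding of [t] substituted into it, which is not a subcontext;
    and the value condition of [ue] looks at the whole surrounding context. Under an ambient
    substitution both become structural, because entering an explicit substitution only extends it
    by one entry ([usub_es]). The flag localises [applicative] likewise, since explicit
    substitutions may stand between a function and its argument.

    A redex [Es t w] is not local for structural equivalence: an axiom applied inside [t] may move
    the occurrence to be replaced, and the contexts of that occurrence before and after are only
    equivalent. This forces a separate simulation for occurrences, next to the one for reductions.

    On the machine side the index of a name depends on the names in scope, and a name outside the
    scope becomes a dangling index. Well-naming and scoping must therefore be preserved together, so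
    that a change of scope amounts to a shift. *)

Ltac use_ih := match goal with IH : forall r, _ |- _ => eapply IH end.

(** The concrete renamings compared below are built from [S], [upr] and [swap01]; after three case
    distinctions on the index both sides compute. *)
Ltac cases_nat := intros [|[|[|?]]]; reflexivity.

(** * Algebra of renaming, substitution and unfolding *)

Lemma ren_ext (K : Type) (t : term K) : forall r r',
  (forall n, r n = r' n) -> ren r t = ren r' t.
Proof.
  induction t; intros r r' H; simpl; auto; f_equal; auto;
    use_ih; intros [|m]; simpl; auto.
Qed.

Lemma ren_ren (K : Type) (t : term K) : forall r1 r2,
  ren r2 (ren r1 t) = ren (fun n => r2 (r1 n)) t.
Proof.
  induction t; intros r1 r2; simpl; auto; f_equal; auto;
    [rewrite IHt | rewrite IHt1]; apply ren_ext; intros [|m]; reflexivity.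
Qed.

Lemma ren_id (K : Type) (t : term K) : forall r,
  (forall n, r n = n) -> ren r t = t.
Proof.
  induction t; intros r H; simpl; auto; f_equal; auto;
    use_ih; intros [|m]; simpl; auto.
Qed.

Lemma sub_ren (K : Type) (t : term K) : forall r s s',
  (forall n, s (r n) = s' n) -> sub s (ren r t) = sub s' t.
Proof.
  induction t; intros r s s' H; simpl; auto; f_equal; eauto;
    use_ih; intros [|m]; simpl; congruence.
Qed.

Lemma ren_sub (K : Type) (t : term K) : forall r s s',
  (forall n, ren r (s n) = s' n) -> ren r (sub s t) = sub s' t.
Proof.
  induction t; intros r s s' H; simpl; auto; f_equal; eauto;
    use_ih; intros [|m]; simpl; auto;
    rewrite <- H, !ren_ren; reflexivity.
Qed.

Lemma sub_sub (K : Type) (t : term K) : forall s1 s2 s3,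
  (forall n, sub s2 (s1 n) = s3 n) -> sub s2 (sub s1 t) = sub s3 t.
Proof.
  induction t; intros s1 s2 s3 H; simpl; auto; f_equal; eauto;
    use_ih; intros [|m]; simpl; auto;
    rewrite <- H; erewrite sub_ren by reflexivity;
    symmetry; apply ren_sub; reflexivity.
Qed.

Lemma sub_id (K : Type) (t : term K) : forall s,
  (forall n, s n = Var n) -> sub s t = t.
Proof.
  induction t; intros s H; simpl; auto; f_equal; auto;
    use_ih; intros [|m]; simpl; auto; rewrite H; reflexivity.
Qed.

Definition scons (K : Type) (a : term K) (s : nat -> term K) (n : nat) : term K :=
  match n with 0 => a | S m => s m end.

(** Here and in [sub_sub_single], substituting before or after instantiating a binder reduces to the
    same [scons]; this makes unfolding commute with substitution. *)
Lemma sub_single_ups (K : Type) (t u : term K) s :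
  sub (single u) (sub (ups s) t) = sub (scons u s) t.
Proof.
  apply sub_sub. intros [|n]; simpl; auto.
  erewrite sub_ren by reflexivity. apply sub_id. reflexivity.
Qed.

Lemma sub_sub_single (K : Type) (t u : term K) s :
  sub s (sub (single u) t) = sub (scons (sub s u) s) t.
Proof. apply sub_sub. intros [|n]; reflexivity. Qed.

Lemma unfold_ren (K : Type) (t : term K) : forall r,
  unfold (ren r t) = ren r (unfold t).
Proof.
  induction t; intros r; simpl; auto; try (f_equal; auto; fail).
  rewrite IHt1, IHt2. erewrite sub_ren by reflexivity.
  symmetry. apply ren_sub. intros [|n]; reflexivity.
Qed.

Lemma unfold_sub (K : Type) (t : term K) : forall s s',
  (forall n, unfold (s n) = s' n) -> unfold (sub s t) = sub s' (unfold t).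
Proof.
  assert (U : forall s s' : nat -> term K, (forall n, unfold (s n) = s' n) ->
            forall n, unfold (ups s n) = ups s' n).
  { intros s s' H [|n]; simpl; auto. rewrite unfold_ren, H. reflexivity. }
  induction t; intros s s' H; simpl; auto; try (f_equal; auto; fail).
  rewrite (IHt1 _ (ups s')), (IHt2 _ s'), sub_single_ups, sub_sub_single; auto.
Qed.

Lemma lambda_ren (K : Type) (t : term K) : forall r,
  lambda_term t -> lambda_term (ren r t).
Proof. induction t; simpl; intuition. Qed.

Lemma lambda_ren_inv (K : Type) (t : term K) : forall r,
  lambda_term (ren r t) -> lambda_term t.
Proof. induction t; simpl; firstorder. Qed.

Lemma lambda_sub (K : Type) (t : term K) : forall s,
  (forall n, lambda_term (s n)) -> lambda_term t -> lambda_term (sub s t).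
Proof.
  assert (U : forall s : nat -> term K, (forall n, lambda_term (s n)) ->
            forall n, lambda_term (ups s n)).
  { intros s H [|n]; simpl; auto. apply lambda_ren, H. }
  induction t; simpl; intuition.
Qed.

Lemma lambda_unfold (K : Type) (t : term K) : lambda_term (unfold t).
Proof.
  induction t; simpl; auto. apply lambda_sub; auto. intros [|n]; simpl; auto.
Qed.

Lemma unfold_lambda (K : Type) (t : term K) : lambda_term t -> unfold t = t.
Proof. induction t; simpl; intros; f_equal; intuition. Qed.

(** Meant for [s] whose values contain no explicit substitution; it is then the unfolding of
    [sub s t]. *)
Definition usub (K : Type) (s : nat -> term K) (t : term K) : term K :=
  sub s (unfold t).

Lemma usub_es (K : Type) s (t u : term K) :
  usub s (Es t u) = usub (scons (usub s u) s) t.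
Proof. apply sub_sub_single. Qed.

Lemma usub_app (K : Type) s (t u : term K) :
  usub s (App t u) = App (usub s t) (usub s u).
Proof. reflexivity. Qed.

Lemma usub_ren (K : Type) (t : term K) r s s' :
  (forall n, s (r n) = s' n) -> usub s (ren r t) = usub s' t.
Proof. intros H. unfold usub. rewrite unfold_ren. apply sub_ren, H. Qed.

Lemma usub_shift (K : Type) (t a : term K) s : usub (scons a s) (ren S t) = usub s t.
Proof. apply usub_ren. reflexivity. Qed.

Lemma scons_upr (K : Type) (a : term K) s s' r :
  (forall n, s (r n) = s' n) -> forall n, scons a s (upr r n) = scons a s' n.
Proof. intros H [|n]; simpl; auto. Qed.

(** * Capture-free filling, and renaming and substitution on contexts *)

(** The hole is filled without capture: the binders above the hole shift [v]. *)
Fixpoint fill (K : Type) (C : sctx K) (v : term K) : term K :=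
  match C with
  | SHole => v
  | SAppL C u => App (fill C v) u
  | SAppR u C => App u (fill C v)
  | SEs C u => Es (fill C (ren S v)) u
  end.

(** With [fill], the variable of a surrounding explicit substitution is always written [Var 0], with
    no mention of the depth of the context. *)
Lemma fill_plug (K : Type) (C : sctx K) : forall v,
  fill C v = plug C (ren (Nat.add (depth C)) v).
Proof.
  induction C; intros v; simpl; [| rewrite IHC; reflexivity | rewrite IHC; reflexivity |].
  - symmetry. apply ren_id. reflexivity.
  - rewrite IHC, ren_ren. f_equal. f_equal. apply ren_ext. intros; lia.
Qed.

Lemma ren_fill (K : Type) (C : sctx K) : forall r v,
  ren r (fill C v) = fill (ren_ctx r C) (ren r v).
Proof.
  induction C; intros r v; simpl; f_equal; auto.
  rewrite IHC, !ren_ren. reflexivity.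
Qed.

(** The side conditions of the axioms are expressed by renamings, so occurrences have to be traced
    back through them; this works because renamings preserve the shape of a term. *)
Lemma fill_var_ren_inv (K : Type) (C : sctx K) : forall r x t,
  fill C (Var x) = ren r t ->
  exists C' y, t = fill C' (Var y) /\ C = ren_ctx r C' /\ x = r y.
Proof.
  induction C; intros r x [m|a|t0|t1 t2|t1 t2] H; simpl in H; inversion H; subst.
  - exists SHole, m; auto.
  - destruct (IHC _ _ _ H1) as (C' & y & -> & -> & ->).
    exists (SAppL C' t2), y; auto.
  - destruct (IHC _ _ _ H2) as (C' & y & -> & -> & ->).
    exists (SAppR t1 C'), y; auto.
  (* Under the binder the occurrence has index [S x], so its preimage by [upr r] is not [0]. *)
  - destruct (IHC _ _ _ H1) as (C' & [|y] & -> & -> & Hy); simpl in Hy; inversion Hy.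
    exists (SEs C' t2), y; auto.
Qed.

Lemma ren_ctx_ext (K : Type) (C : sctx K) : forall r r',
  (forall n, r n = r' n) -> ren_ctx r C = ren_ctx r' C.
Proof.
  induction C; intros r r' H; simpl; f_equal; auto using ren_ext.
  apply IHC. intros [|m]; simpl; auto.
Qed.

Lemma ren_ctx_ren_ctx (K : Type) (C : sctx K) : forall r1 r2,
  ren_ctx r2 (ren_ctx r1 C) = ren_ctx (fun n => r2 (r1 n)) C.
Proof.
  induction C; intros r1 r2; simpl; f_equal; auto using ren_ren.
  rewrite IHC. apply ren_ctx_ext. intros [|m]; reflexivity.
Qed.

Lemma ren_ctx_id (K : Type) (C : sctx K) : forall r,
  (forall n, r n = n) -> ren_ctx r C = C.
Proof.
  induction C; intros r H; simpl; f_equal; auto using ren_id.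
  apply IHC. intros [|m]; simpl; auto.
Qed.

Ltac ren_eq :=
  rewrite ?ren_ren, ?ren_ctx_ren_ctx;
  first [reflexivity | apply ren_ext; cases_nat | apply ren_ctx_ext; cases_nat].

Lemma sub_ctx_comp (K : Type) (C : sctx K) : forall s1 s2 s3,
  (forall n, sub s2 (s1 n) = s3 n) -> sub_ctx s2 (sub_ctx s1 C) = sub_ctx s3 C.
Proof.
  induction C; intros s1 s2 s3 H; simpl; f_equal; eauto using sub_sub.
  apply IHC. intros [|m]; simpl; auto.
  rewrite <- H. erewrite sub_ren by reflexivity.
  symmetry. apply ren_sub. reflexivity.
Qed.

Lemma sub_ctx_id (K : Type) (C : sctx K) : forall s,
  (forall n, s n = Var n) -> sub_ctx s C = C.
Proof.
  induction C; intros s H; simpl; f_equal; auto using sub_id.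
  apply IHC. intros [|m]; simpl; auto. rewrite H. reflexivity.
Qed.

Lemma sub_ctx_single_ups (K : Type) (C : sctx K) u s :
  sub_ctx (single u) (sub_ctx (ups s) C) = sub_ctx (scons u s) C.
Proof.
  apply sub_ctx_comp. intros [|n]; simpl; auto.
  erewrite sub_ren by reflexivity. apply sub_id. reflexivity.
Qed.

(** * Fireballs, and reduction under an ambient substitution *)

Lemma fireball_iff (K : Type) (t : term K) : fireball t <-> value t \/ inert t.
Proof. split; [intros []; auto | intros []; [apply fireball_value | apply fireball_inert]; auto]. Qed.

Lemma inert_app_iff (K : Type) (t u : term K) :
  inert (App t u) <-> inert t /\ fireball u.
Proof. split; [inversion 1; auto | intros []; constructor; auto]. Qed.

Lemma not_inert_lam (K : Type) (t : term K) : ~ inert (Lam t).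
Proof. inversion 1. Qed.

Lemma fireball_app_iff (K : Type) (t u : term K) :
  fireball (App t u) <-> inert t /\ fireball u.
Proof.
  rewrite fireball_iff, inert_app_iff. split; auto.
  intros [[b H] | H]; [discriminate | auto].
Qed.

(** Evaluable contexts, whose free variables stand for the terms given by the
    substitution [s]; the flag tells that the context is moreover in applied
    position, so that [ev false s C] describes useful contexts. *)
Fixpoint ev (K : Type) (b : bool) (s : nat -> term K) (C : sctx K) : Prop :=
  match C with
  | SHole => b = true
  | SAppL C t => ev true s C /\ fireball (usub s t)
  | SAppR t C => ev false s C
  | SEs C t => fireball (usub s t) /\ ev b (scons (usub s t) s) C
  end.

(** The function parts [L<\x.t>] of multiplicative redexes; the fireball conditions are the share of
    [L] in the usefulness of [S<L u>]. *)
Fixpoint answer (K : Type) (s : nat -> term K) (t : term K) : Prop :=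
  match t with
  | Lam _ => True
  | Es t u => fireball (usub s u) /\ answer (scons (usub s u) s) t
  | _ => False
  end.

(** [L<\x.t> u] becomes [L<t[x<-u]>]. *)
Fixpoint beta (K : Type) (t u : term K) : term K :=
  match t with
  | Lam t => Es t u
  | Es t w => Es (beta t (ren S u)) w
  | _ => App t u
  end.

(** [C<x>[x<-L<u>]] becomes [L<C<u>[x<-u]>]. *)
Fixpoint dup (K : Type) (C : sctx K) (t : term K) : term K :=
  match t with
  | Es t w => Es (dup (ren_ctx (upr S) C) t) w
  | _ => Es (fill C (ren S t)) t
  end.

(** The rules without global contexts: [s] gives the unfoldings of the free
    variables bound by the surrounding explicit substitutions, and the flag
    tells whether the term is in applied position. *)
Inductive redS (K : Type) : rule -> bool -> (nat -> term K) -> term K -> term K -> Prop :=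
| redS_um b s t u :
    answer s t -> fireball (usub s u) ->
    redS multiplicative b s (App t u) (beta t u)
| redS_ue b s C t w :
    t = fill C (Var 0) ->
    value (usub s w) -> ev b (scons (usub s w) s) C ->
    redS exponential b s (Es t w) (dup C w)
| redS_appl r b s t t' u :
    redS r true s t t' -> fireball (usub s u) -> redS r b s (App t u) (App t' u)
| redS_appr r b s t u u' :
    redS r false s u u' -> redS r b s (App t u) (App t u')
| redS_es r b s t t' w :
    fireball (usub s w) -> redS r b (scons (usub s w) s) t t' ->
    redS r b s (Es t w) (Es t' w).

(** ** Correspondence with the global rules *)

Fixpoint appl (K : Type) (b : bool) (C : sctx K) : Prop :=
  match C with
  | SHole => b = true
  | SAppL C _ => appl true C
  | SAppR _ C => appl false C
  | SEs C _ => appl b C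
  end.

(** When the flag is [true] the missing argument is supplied from outside, so a mere list of
    explicit substitutions also qualifies. *)
Lemma appl_iff (K : Type) (C : sctx K) : forall b,
  appl b C <-> (applicative C \/ b = true /\ exists L : lctx K, C = L).
Proof.
  assert (A0 : ~ applicative (@SHole K)).
  { intros ([] & L & u & H); discriminate. }
  assert (AL : forall (C : sctx K) t, applicative (SAppL C t) <->
            applicative C \/ exists L : lctx K, C = L).
  { intros C0 t; split.
    - intros ([] & L & u & H); simpl in H; inversion H; subst; eauto.
      left. exists s, L, u. reflexivity.
    - intros [(C' & L & u & ->) | [L ->]].
      + exists (SAppL C' t), L, u. reflexivity.
      + exists SHole, L, t. reflexivity. }
  assert (AR : forall t (C : sctx K), applicative (SAppR t C) <-> applicative C).
  { intros t C0; split.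
    - intros ([] & L & u & H); simpl in H; inversion H; subst.
      exists s, L, u. reflexivity.
    - intros (C' & L & u & ->). exists (SAppR t C'), L, u. reflexivity. }
  assert (AE : forall (C : sctx K) t, applicative (SEs C t) <-> applicative C).
  { intros C0 t; split.
    - intros ([] & L & u & H); simpl in H; inversion H; subst.
      exists s, L, u. reflexivity.
    - intros (C' & L & u & ->). exists (SEs C' t), L, u. reflexivity. }
  induction C as [|C IH t|t C IH|C IH t]; intros b; simpl.
  - split; [intros ->; right; split; auto; exists LHole; reflexivity | tauto].
  - rewrite AL, IH. split; [tauto|].
    intros [[]|[_ [[] H]]]; auto; discriminate.
  - rewrite AR, IH. split; [intros [|[]]; [auto|discriminate]|].
    intros [|[_ [[] H]]]; auto; discriminate.
  - rewrite AE, IH. split; (intros [|[Hb [L HL]]]; [auto | right; split; auto]).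
    + exists (LEs L t). rewrite HL. reflexivity.
    + destruct L; inversion HL; subst; eauto.
Qed.

Lemma unfold_sub_stable (K : Type) s (t : term K) :
  (forall n, lambda_term (s n)) -> unfold (sub s t) = usub s t.
Proof. intros H. apply unfold_sub. intros n. apply unfold_lambda, H. Qed.

Lemma lambda_scons (K : Type) s (t : term K) :
  (forall n, lambda_term (s n)) ->
  forall n, lambda_term (scons (usub s t) s n).
Proof. intros H [|n]; simpl; auto. apply lambda_sub; auto using lambda_unfold. Qed.

(** Generalising over [s] absorbs the substitution that [ev_es] performs in the context. The values
    of [s] are lambda-terms so that instantiating and then unfolding agrees with [usub]. *)
Lemma evaluable_iff (K : Type) (C : sctx K) : forall b s,
  (forall n, lambda_term (s n)) ->
  (evaluable (sub_ctx s C) /\ appl b C <-> ev b s C).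
Proof.
  induction C as [|C IH t|t C IH|C IH t]; intros b s Hs; simpl.
  - split; [tauto | split; auto; constructor].
  - rewrite <- IH, <- unfold_sub_stable by auto. split.
    + intros [H A]. inversion H; auto.
    + intros [[H A] F]. split; auto. constructor; auto.
  - rewrite <- IH by auto. split.
    + intros [H A]. inversion H; auto.
    + intros [H A]. split; auto. constructor; auto.
  - rewrite <- IH by auto using lambda_scons.
    rewrite <- sub_ctx_single_ups, <- unfold_sub_stable by auto. split.
    + intros [H A]. inversion H; auto.
    + intros (F & H & A). split; auto. constructor; auto.
Qed.

Lemma useful_iff (K : Type) (C : sctx K) : useful C <-> ev false Var C.
Proof.
  rewrite <- evaluable_iff by (intros; exact I).
  rewrite sub_ctx_id by reflexivity. rewrite appl_iff. unfold useful.
  split; intros [H A]; split; auto. destruct A as [|[]]; [auto | discriminate].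
Qed.

Lemma answer_iff (K : Type) (t : term K) : forall s,
  answer s t <-> exists (L : lctx K) t', t = plug L (Lam t') /\ ev true s L.
Proof.
  induction t; intros s; simpl; try (split; [tauto|]; intros (L & t' & H & _); destruct L; discriminate).
  - split; [|tauto]. intros _. exists LHole, t. simpl; auto.
  - rewrite IHt1. split.
    + intros (F & L & t' & -> & E). exists (LEs L t2), t'. simpl; auto.
    + intros ([|L w] & t' & H & E); simpl in H; inversion H; subst.
      destruct E. split; auto. exists L, t'. auto.
Qed.

Lemma beta_plug (K : Type) (L : lctx K) : forall t u,
  beta (plug L (Lam t)) u = plug L (Es t (ren (Nat.add (depth L)) u)).
Proof.
  induction L as [|L IH w]; intros t u; simpl.
  - rewrite ren_id; auto.
  - rewrite IH, ren_ren. f_equal. f_equal. f_equal. apply ren_ext. intros; lia.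
Qed.

Lemma depth_ren_ctx (K : Type) (C : sctx K) : forall r, depth (ren_ctx r C) = depth C.
Proof. induction C; intros r; simpl; auto. Qed.

(** [dup] descends through all leading explicit substitutions, so it stops exactly at [u] because
    [u] is not one. The shift [S (depth C)] counts the displayed binder and those of [C]. *)
Lemma dup_plug (K : Type) (L : lctx K) u : ~ is_es u -> forall C : sctx K,
  dup C (plug L u) =
  plug L (Es (plug (ren_ctx (upr (Nat.add (depth L))) C)
                   (ren (Nat.add (S (depth C))) u)) u).
Proof.
  intros Hu. induction L as [|L IH w]; intros C; simpl.
  - rewrite ren_ctx_id by (intros [|]; reflexivity).
    transitivity (Es (fill C (ren S u)) u).
    + destruct u; try reflexivity. destruct Hu. do 2 eexists; reflexivity.
    + f_equal. rewrite fill_plug, ren_ren. f_equal. apply ren_ext. intros; lia.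
  - rewrite IH, ren_ctx_ren_ctx, depth_ren_ctx.
    rewrite (ren_ctx_ext C) with (r' := upr (Nat.add (S (depth L)))); auto.
    intros [|n]; simpl; auto.
Qed.

Lemma split_lctx (K : Type) (w : term K) :
  exists (L : lctx K) u, w = plug L u /\ ~ is_es u.
Proof.
  induction w; try (eexists LHole, _; split; [reflexivity|];
    intros (? & ? & ?); discriminate).
  destruct IHw1 as (L & u & -> & H). exists (LEs L w2), u. auto.
Qed.

Lemma um_redS (K : Type) (C : sctx K) (L : lctx K) t u : forall b s,
  ev b s (comp C (SAppL L u)) ->
  redS multiplicative b s (plug C (App (plug L (Lam t)) u))
       (plug C (beta (plug L (Lam t)) u)).
Proof.
  induction C; simpl; intros b s.
  - intros [H F]. apply redS_um; auto. apply answer_iff. eauto.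
  - intros []. apply redS_appl; auto.
  - intros. apply redS_appr; auto.
  - intros []. apply redS_es; auto.
Qed.

(** This is why [redS_ue] can test the whole body [w]: unfolding [u] relative to [S<L>] is unfolding
    [L<u>] relative to [S]. *)
Lemma unfold_in_lctx (K : Type) (L : lctx K) u :
  unfold_in u L = unfold (plug L u).
Proof. induction L; simpl; auto. rewrite IHL. reflexivity. Qed.

Lemma ue_redS (K : Type) (C C' : sctx K) (L : lctx K) u : forall b s,
  ev b s (comp C (SEs C' (plug L u))) ->
  value (sub s (unfold_in u (comp C L))) ->
  redS exponential b s (plug C (Es (fill C' (Var 0)) (plug L u)))
       (plug C (dup C' (plug L u))).
Proof.
  induction C as [|C IH t|t C IH|C IH t]; simpl; intros b s.
  - rewrite unfold_in_lctx. intros [H F] V. apply redS_ue; auto.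
  - intros [] V. apply redS_appl; auto.
  - intros E V. apply redS_appr; auto.
  - intros [] V. apply redS_es; auto. apply IH; auto.
    rewrite sub_sub_single in V. exact V.
Qed.

Lemma plug_var (K : Type) (C : sctx K) n :
  plug C (Var (depth C + n)) = fill C (Var n).
Proof. rewrite fill_plug. reflexivity. Qed.

Lemma uf_redS (K : Type) r (t t' : term K) : uf r t t' -> redS r false Var t t'.
Proof.
  destruct r; simpl.
  - intros [C L t0 u H]. apply useful_iff in H. rewrite <- beta_plug. apply um_redS, H.
  - intros [C C' L u H N V]. apply useful_iff in H.
    rewrite <- dup_plug by auto. rewrite <- (Nat.add_0_r (depth C')) at 1.
    rewrite plug_var. apply ue_redS; auto. rewrite sub_id; auto.
Qed.

Lemma redS_um_inv (K : Type) r b s (t t' : term K) :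
  redS r b s t t' -> r = multiplicative ->
  exists (C : sctx K) (L : lctx K) t0 u,
    t = plug C (App (plug L (Lam t0)) u) /\
    t' = plug C (beta (plug L (Lam t0)) u) /\
    ev b s (comp C (SAppL L u)).
Proof.
  induction 1; intros Hr; try discriminate;
    try (destruct (IHredS Hr) as (C & L & t0 & u0 & -> & -> & E)).
  - apply answer_iff in H. destruct H as (L & t' & -> & E).
    exists SHole, L, t', u. simpl. auto.
  - exists (SAppL C u), L, t0, u0. simpl; auto.
  - exists (SAppR t C), L, t0, u0. simpl; auto.
  - exists (SEs C w), L, t0, u0. simpl; auto.
Qed.

Lemma redS_ue_inv (K : Type) r b s (t t' : term K) :
  redS r b s t t' -> r = exponential ->
  exists (C C' : sctx K) (L : lctx K) u,
    t = plug C (Es (fill C' (Var 0)) (plug L u)) /\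
    t' = plug C (dup C' (plug L u)) /\ ~ is_es u /\
    ev b s (comp C (SEs C' (plug L u))) /\
    value (sub s (unfold_in u (comp C L))).
Proof.
  induction 1; intros Hr; try discriminate;
    try (destruct (IHredS Hr) as (C & C' & L & u0 & -> & -> & N & E & V)).
  - destruct (split_lctx w) as (L & u & -> & N). subst t.
    exists SHole, C, L, u. simpl. rewrite unfold_in_lctx.
    repeat split; auto. apply fireball_value; auto.
  - exists (SAppL C u), C', L, u0. simpl; auto 9.
  - exists (SAppR t C), C', L, u0. simpl; auto 9.
  - exists (SEs C w), C', L, u0. simpl. rewrite sub_sub_single. auto 9.
Qed.

Lemma redS_uf (K : Type) r (t t' : term K) : redS r false Var t t' -> uf r t t'.
Proof.
  intros H. destruct r; simpl.
  - destruct (redS_um_inv H eq_refl) as (C & L & t0 & u & -> & -> & E).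
    rewrite beta_plug. constructor. apply useful_iff, E.
  - destruct (redS_ue_inv H eq_refl) as (C & C' & L & u & -> & -> & N & E & V).
    rewrite dup_plug by auto. rewrite <- plug_var, Nat.add_0_r. constructor; auto.
    + apply useful_iff, E.
    + rewrite sub_id in V; auto.
Qed.

(** ** Determinism *)

(** A term in applied position is harmless only when it unfolds to an inert
    term, since an applied value is a redex. *)
Definition reducible_unfolding (K : Type) (b : bool) (t : term K) : Prop :=
  if b then ~ inert t else ~ fireball t.

Lemma reducible_unfolding_false (K : Type) b (t : term K) :
  ~ fireball t -> reducible_unfolding b t.
Proof. rewrite fireball_iff. destruct b; simpl; rewrite ?fireball_iff; tauto. Qed.

(** The hole is applied, and an applied value is not a fireball; the failure propagates outwards,
    since a fireball application has an inert function and a fireball argument. *)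
Lemma ev_reducible (K : Type) x (C : sctx K) : forall b s,
  ev b s C -> value (s x) -> reducible_unfolding b (usub s (fill C (Var x))).
Proof.
  revert x. induction C; simpl; intros x b s.
  - intros -> [u H]. cbn. rewrite H. apply not_inert_lam.
  - intros [E F] V. apply reducible_unfolding_false. rewrite usub_app, fireball_app_iff.
    intros [I _]. exact (IHC _ _ _ E V I).
  - intros E V. apply reducible_unfolding_false. rewrite usub_app, fireball_app_iff.
    intros [_ I]. exact (IHC _ _ _ E V I).
  - intros [F E] V. rewrite usub_es. apply (IHC (S x)); auto.
Qed.

Lemma answer_value (K : Type) (t : term K) : forall s, answer s t -> value (usub s t).
Proof.
  induction t; simpl; intros s H; try tauto.
  - eexists. reflexivity.
  - rewrite usub_es. apply IHt1, H.
Qed.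

Lemma redS_reducible (K : Type) r b s (t t' : term K) :
  redS r b s t t' -> reducible_unfolding b (usub s t).
Proof.
  induction 1.
  - apply reducible_unfolding_false. rewrite usub_app, fireball_app_iff.
    intros [I _]. apply answer_value in H. destruct H as [v Hv].
    rewrite Hv in I. exact (not_inert_lam I).
  - rewrite usub_es. subst t. apply ev_reducible; auto.
  - apply reducible_unfolding_false. rewrite usub_app, fireball_app_iff. intuition.
  - apply reducible_unfolding_false. rewrite usub_app, fireball_app_iff. intuition.
  - rewrite usub_es. auto.
Qed.

Lemma answer_fill (K : Type) (C : sctx K) : forall s x, ~ answer s (fill C (Var x)).
Proof.
  induction C; simpl; intros s x H; auto. apply (IHC _ _ (proj2 H)).
Qed.

(** Separates a multiplicative redex from reductions inside its function part: reduction does not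
    enter abstractions, and the body of an answer does not end in a replaceable variable. *)
Lemma answer_normal (K : Type) r b s (t t' : term K) :
  redS r b s t t' -> ~ answer s t.
Proof.
  induction 1; simpl; auto.
  - subst t. intros [_ A]. eapply answer_fill; exact A.
  - tauto.
Qed.

Lemma ev_not_fireball (K : Type) (C : sctx K) s x :
  ev false s C -> value (s x) -> ~ fireball (usub s (fill C (Var x))).
Proof. intros E V. exact (@ev_reducible K x C false s E V). Qed.

Lemma redS_not_fireball (K : Type) r s (t t' : term K) :
  redS r false s t t' -> ~ fireball (usub s t).
Proof. exact (@redS_reducible K r false s t t'). Qed.

(** If the two holes lay on different sides of an application, the right-hand side would have to be
    a fireball for one context and, by [ev_not_fireball], could not be one for the other. *)
Lemma fill_unique (K : Type) (C1 : sctx K) : forall C2 b s x y,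
  ev b s C1 -> ev b s C2 -> value (s x) -> value (s y) ->
  fill C1 (Var x) = fill C2 (Var y) -> C1 = C2 /\ x = y.
Proof.
  induction C1 as [|C1 IH t|t C1 IH|C1 IH t]; intros [|C2 t2|t2 C2|C2 t2] b s x y;
    simpl; intros E1 E2 V1 V2 H; inversion H; subst; auto.
  - destruct (IH C2 true s x y) as [-> ->]; tauto.
  - exfalso. eapply ev_not_fireball; [exact E2 | exact V2 | apply E1].
  - exfalso. eapply ev_not_fireball; [exact E1 | exact V1 | apply E2].
  - destruct (IH C2 false s x y) as [-> ->]; tauto.
  - destruct (IH C2 b (scons (usub s t2) s) (S x) (S y)) as [-> Hxy]; try tauto.
    inversion Hxy; auto.
Qed.

(** Rules out a conflict between firing an explicit substitution and reducing inside its body. *)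
Lemma fill_normal (K : Type) (C : sctx K) : forall r b s x t',
  ev b s C -> value (s x) -> ~ redS r b s (fill C (Var x)) t'.
Proof.
  induction C as [|C IH t|t C IH|C IH t]; simpl; intros r b s x t' E V R;
    inversion R; subst.
  - eapply answer_fill; eauto.
  - eapply IH; [apply E | apply V | eauto].
  - eapply redS_not_fireball; [eassumption | apply E].
  - eapply ev_not_fireball; eauto.
  - eapply ev_not_fireball; eauto.
  - eapply IH; eauto.
  (* The two occurrences would coincide, although one has index [0] and the other a successor. *)
  - match goal with H : fill _ _ = _ |- _ =>
      apply (@fill_unique K _ _ b (scons (usub s t) s)) in H end; simpl; try tauto.
    destruct H1; discriminate.
  - eapply (IH r b _ (S x)); [apply E | apply V | eauto].
Qed.

Lemma redS_deterministic (K : Type) r1 b s (t t1 : term K) :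
  redS r1 b s t t1 -> forall r2 t2, redS r2 b s t t2 -> t1 = t2.
Proof.
  induction 1; intros r2 t2 R; inversion R; subst; auto.
  - edestruct answer_normal; eauto.
  - edestruct redS_not_fireball; eauto.
  - match goal with H : fill _ _ = _ |- _ =>
      apply (@fill_unique K _ _ b (scons (usub s w) s)) in H end; auto.
    match goal with H : _ /\ _ |- _ => destruct H; subst; auto end.
  - edestruct fill_normal; eauto. assumption.
  - exfalso. eapply answer_normal; [exact H | assumption].
  - f_equal; eauto.
  - edestruct redS_not_fireball; eauto.
  - edestruct redS_not_fireball; eauto.
  - edestruct redS_not_fireball; eauto.
  - f_equal; eauto.
  - edestruct fill_normal; eauto. assumption.
  - f_equal; eauto.
Qed.

(** * Stability of reduction under renaming *)

Lemma ren_beta (K : Type) (t : term K) : forall r u,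
  ren r (beta t u) = beta (ren r t) (ren r u).
Proof.
  induction t; intros r w; simpl; auto. rewrite IHt1. f_equal. f_equal. ren_eq.
Qed.

Lemma ren_upr_shift (K : Type) (t : term K) r :
  ren (upr r) (ren S t) = ren S (ren r t).
Proof. rewrite !ren_ren. reflexivity. Qed.

Lemma ren_dup (K : Type) (w : term K) : forall r C,
  ren r (dup C w) = dup (ren_ctx (upr r) C) (ren r w).
Proof.
  induction w; intros r C;
    try (unfold dup; change (ren r (Es ?t ?u)) with (Es (ren (upr r) t) (ren r u));
         rewrite ren_fill, ren_upr_shift; reflexivity).
  simpl. rewrite IHw1. f_equal. f_equal. ren_eq.
Qed.

Lemma ev_ren (K : Type) (C : sctx K) : forall b r s s',
  (forall n, s (r n) = s' n) -> (ev b s (ren_ctx r C) <-> ev b s' C).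
Proof.
  induction C; simpl; intros b r s' s'' H; rewrite ?(@usub_ren _ _ r s' s'') by auto.
  - tauto.
  - rewrite (IHC _ _ _ s''); tauto.
  - auto.
  - rewrite (IHC _ _ _ (scons (usub s'' t) s'')); [tauto | apply scons_upr, H].
Qed.

Lemma answer_ren (K : Type) (t : term K) : forall r s s',
  (forall n, s (r n) = s' n) -> (answer s (ren r t) <-> answer s' t).
Proof.
  induction t; simpl; intros r s s' H; try tauto.
  rewrite (@usub_ren _ _ r s s') by auto.
  rewrite (IHt1 _ _ (scons (usub s' t2) s')); [tauto | apply scons_upr, H].
Qed.

Lemma redS_ren (K : Type) l b s' (t t' : term K) : redS l b s' t t' ->
  forall r s, (forall n, s (r n) = s' n) -> redS l b s (ren r t) (ren r t').
Proof.
  induction 1; intros r0 s0 Hs; simpl;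
    pose proof (fun t => @usub_ren _ t r0 s0 s Hs) as Hu.
  - rewrite ren_beta. apply redS_um; rewrite ?Hu; auto.
    eapply answer_ren; eauto.
  - rewrite ren_dup. apply redS_ue; rewrite ?Hu; auto.
    + subst t. apply ren_fill.
    + eapply ev_ren; [apply scons_upr, Hs | auto].
  - apply redS_appl; rewrite ?Hu; auto.
  - apply redS_appr; auto.
  - apply redS_es; rewrite ?Hu; auto. apply IHredS, scons_upr, Hs.
Qed.

(** What a side condition on free variables buys: a subterm that skips a bound variable reduces in
    its scope exactly as it does outside. *)
Lemma redS_ren_inv (K : Type) (t : term K) : forall l b r s s' u,
  (forall n, s (r n) = s' n) -> redS l b s (ren r t) u ->
  exists t', u = ren r t' /\ redS l b s' t t'.
Proof.
  induction t as [| | |t1 IH1 t2 IH2|t1 IH1 t2 IH2]; intros l b r s s' u' Hs R;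
    simpl in R; inversion R; subst;
    pose proof (fun t => @usub_ren _ t r s s' Hs) as Hu; rewrite ?Hu in *.
  - exists (beta t1 t2). rewrite ren_beta. split; auto. apply redS_um; auto.
    eapply answer_ren; eauto.
  - match goal with H : redS _ _ _ _ _ |- _ =>
      destruct (IH1 _ _ _ _ _ _ Hs H) as (t0 & -> & R0) end.
    exists (App t0 t2). split; auto. apply redS_appl; auto.
  - match goal with H : redS _ _ _ _ _ |- _ =>
      destruct (IH2 _ _ _ _ _ _ Hs H) as (t0 & -> & R0) end.
    exists (App t1 t0). split; auto. apply redS_appr; auto.
  - match goal with H : ren _ _ = fill _ _ |- _ => symmetry in H;
      apply fill_var_ren_inv in H; destruct H as (C' & [|y] & -> & -> & Hy);
      simpl in Hy; inversion Hy end.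
    exists (dup C' t2). rewrite ren_dup. split; auto. apply redS_ue; auto.
    eapply ev_ren; [|eassumption]. apply scons_upr, Hs.
  - match goal with H : redS _ _ _ _ _ |- _ => eapply IH1 in H;
      [destruct H as (t0 & -> & R0) | apply scons_upr, Hs] end.
    exists (Es t0 t2). split; auto. apply redS_es; auto.
Qed.

(** ** The invariant of generated terms *)

(** Reduction and equivalence are weak, so bodies of abstractions stay free of explicit
    substitutions; a body opened by [beta] then satisfies the invariant for whatever ambient
    substitution it meets. *)
Fixpoint fireball_es (K : Type) (s : nat -> term K) (t : term K) : Prop :=
  match t with
  | Var _ | Cst _ => True
  | Lam t => lambda_term t
  | App t u => fireball_es s t /\ fireball_es s u
  | Es t u =>
      fireball_es s u /\ fireball (usub s u) /\ fireball_es (scons (usub s u) s) t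
  end.

Lemma fireball_es_lambda (K : Type) (t : term K) : forall s,
  lambda_term t -> fireball_es s t.
Proof. induction t; simpl; intuition. Qed.

Lemma fireball_es_ren (K : Type) (t : term K) : forall r s s',
  (forall n, s (r n) = s' n) -> (fireball_es s (ren r t) <-> fireball_es s' t).
Proof.
  induction t; simpl; intros r s s' H; try tauto.
  - split; [apply lambda_ren_inv | apply lambda_ren].
  - rewrite (IHt1 _ _ _ H), (IHt2 _ _ _ H). tauto.
  - rewrite (@usub_ren _ _ r s s'), (IHt2 _ _ _ H) by auto.
    rewrite (IHt1 _ _ (scons (usub s' t2) s')); [tauto | apply scons_upr, H].
Qed.

Lemma fireball_es_shift (K : Type) (t a : term K) s :
  fireball_es (scons a s) (ren S t) <-> fireball_es s t.
Proof. apply fireball_es_ren. reflexivity. Qed.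

Lemma fireball_es_beta (K : Type) (t : term K) : forall s u,
  fireball_es s t -> fireball_es s u -> fireball (usub s u) ->
  fireball_es s (beta t u).
Proof.
  induction t; simpl; intros s u Ht Hu F; auto.
  - auto using fireball_es_lambda.
  - destruct Ht as (H1 & H2 & H3). repeat split; auto.
    apply IHt1; rewrite ?fireball_es_shift, ?usub_shift; auto.
Qed.

Lemma fireball_es_fill (K : Type) (C : sctx K) : forall s x v,
  fireball_es s (fill C (Var x)) -> fireball_es s v -> fireball_es s (fill C v).
Proof.
  induction C; simpl; intros s x v H Hv; auto.
  - destruct H; eauto.
  - destruct H; eauto.
  - destruct H as (H1 & H2 & H3). repeat split; auto.
    eapply IHC; eauto. apply fireball_es_shift, Hv.
Qed.

Lemma fireball_es_dup (K : Type) (w : term K) : forall C s,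
  fireball_es s (Es (fill C (Var 0)) w) -> fireball_es s (dup C w).
Proof.
  induction w; intros C s (H1 & H2 & H3);
    try (split; [exact H1|]; split; [exact H2|]; eapply fireball_es_fill;
         [exact H3 | apply fireball_es_shift; exact H1]).
  destruct H1 as (H4 & H5 & H6). repeat split; auto.
  rewrite usub_es in H2, H3. apply IHw1. simpl. repeat split; auto.
  (* [upr S] fixes [0], so the occurrence survives when [C] moves under the binder of the floated
     substitution. *)
  change (Var 0) with (ren (upr S) (@Var K 0)). rewrite <- ren_fill.
  eapply fireball_es_ren; [|exact H3]. intros [|n]; reflexivity.
Qed.

Lemma fireball_es_redS (K : Type) l b s (t t' : term K) :
  redS l b s t t' -> fireball_es s t -> fireball_es s t'.
Proof.
  induction 1; simpl.
  - intros []. apply fireball_es_beta; auto.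
  - subst t. apply fireball_es_dup.
  - tauto.
  - tauto.
  - tauto.
Qed.

(** ** Structural equivalence *)

Lemma equiv_appl (K : Type) (t t' u : term K) : equiv t t' -> equiv (App t u) (App t' u).
Proof. apply (equiv_ctx (WAppL WHole u)). Qed.

Lemma equiv_appr (K : Type) (t u u' : term K) : equiv u u' -> equiv (App t u) (App t u').
Proof. apply (equiv_ctx (WAppR t WHole)). Qed.

Lemma equiv_esl (K : Type) (t t' u : term K) : equiv t t' -> equiv (Es t u) (Es t' u).
Proof. apply (equiv_ctx (WEsL WHole u)). Qed.

Lemma equiv_esr (K : Type) (t u u' : term K) : equiv u u' -> equiv (Es t u) (Es t u').
Proof. apply (equiv_ctx (WEsR t WHole)). Qed.

(** Replaces arbitrary weak contexts by single layers. The equivalences are kept as premises so that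
    the invariant can be transported in the symmetry and transitivity cases. *)
Lemma equiv_closed (K : Type) (P : term K -> term K -> Prop) :
  (forall t u, equiv_ax t u -> P t u) ->
  (forall t, P t t) -> (forall t u, equiv t u -> P t u -> P u t) ->
  (forall t u w, equiv t u -> equiv u w -> P t u -> P u w -> P t w) ->
  (forall t t' u, equiv t t' -> P t t' -> P (App t u) (App t' u)) ->
  (forall t u u', equiv u u' -> P u u' -> P (App t u) (App t u')) ->
  (forall t t' u, equiv t t' -> P t t' -> P (Es t u) (Es t' u)) ->
  (forall t u u', equiv u u' -> P u u' -> P (Es t u) (Es t u')) ->
  forall t u, equiv t u -> P t u.
Proof.
  intros Hax Hr Hs Ht Hal Har Hel Her t u E.
  induction E as [t u A|t|t u E IH|t u w E1 IH1 E2 IH2|W t u E IH]; eauto.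
  induction W; simpl; auto using equiv_ctx.
Qed.

Lemma equiv_ren (K : Type) (t u : term K) : equiv t u -> forall r, equiv (ren r t) (ren r u).
Proof.
  revert t u. apply (@equiv_closed K (fun t u => forall r, equiv (ren r t) (ren r u)));
    simpl; eauto using equiv_refl, equiv_sym, equiv_trans, equiv_appl, equiv_appr,
      equiv_esl, equiv_esr.
  intros t u [] r; simpl; rewrite ?ren_ren.
  - replace (ren (fun n => upr (upr r) (swap01 n)) t0)
      with (ren swap01 (ren (upr (upr r)) t0)) by ren_eq.
    change (ren (fun n => upr r (S n)) u0) with (ren (fun n => S (r n)) u0).
    change (ren (fun n => upr r (S n)) w) with (ren (fun n => S (r n)) w).
    rewrite <- (ren_ren u0 r S), <- (ren_ren w r S). apply equiv_in_ax, ax_com.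
  - change (ren (fun n => upr r (S n)) t0) with (ren (fun n => S (r n)) t0).
    rewrite <- (ren_ren t0 r S). apply equiv_in_ax, ax_appr.
  - change (ren (fun n => upr r (S n)) w) with (ren (fun n => S (r n)) w).
    rewrite <- (ren_ren w r S). apply equiv_in_ax, ax_appl.
  - replace (ren (fun n => upr (upr r) (upr S n)) t0)
      with (ren (upr S) (ren (upr r) t0)) by ren_eq.
    apply equiv_in_ax, ax_nest.
Qed.

Lemma usub_swap (K : Type) (t a c : term K) s :
  usub (scons a (scons c s)) (ren swap01 t) = usub (scons c (scons a s)) t.
Proof. apply usub_ren. cases_nat. Qed.

Lemma usub_nest (K : Type) (t a c : term K) s :
  usub (scons a (scons c s)) (ren (upr S) t) = usub (scons a s) t.
Proof. apply usub_ren. cases_nat. Qed.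

(** Every fireball or value condition of the rules only looks at unfoldings, hence is stable under
    equivalence. *)
Lemma usub_equiv (K : Type) (t u : term K) : equiv t u -> forall s, usub s t = usub s u.
Proof.
  revert t u.
  apply (@equiv_closed K (fun t u => forall s, usub s t = usub s u)); auto.
  - intros t u [] s; rewrite ?usub_es, ?usub_app, ?usub_es, ?usub_shift;
      rewrite ?usub_swap, ?usub_nest, ?usub_es; reflexivity.
  - intros t u w _ _ H1 H2 s. rewrite H1. auto.
  - intros t t' u _ H s. rewrite !usub_app, H. reflexivity.
  - intros t t' u _ H s. rewrite !usub_app, H. reflexivity.
  - intros t t' u _ H s. rewrite !usub_es, H. reflexivity.
  - intros t t' u _ H s. rewrite !usub_es, H. reflexivity.
Qed.

Lemma fireball_es_equiv (K : Type) (t u : term K) : equiv t u ->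
  forall s, fireball_es s t <-> fireball_es s u.
Proof.
  revert t u.
  apply (@equiv_closed K (fun t u => forall s, fireball_es s t <-> fireball_es s u)).
  - intros t u [t0 u0 w|t0 w u0|t0 w u0|t0 u0 w] s; simpl;
      rewrite ?usub_es, ?usub_shift, ?fireball_es_shift; try tauto.
    + rewrite (@fireball_es_ren _ t0 swap01 _
        (scons (usub s u0) (scons (usub s w) s))) by cases_nat. tauto.
    + rewrite (@fireball_es_ren _ t0 (upr S) _
        (scons (usub (scons (usub s w) s) u0) s)) by cases_nat. tauto.
  - tauto.
  - intros t u _ H s. symmetry. auto.
  - intros t u w _ _ H1 H2 s. rewrite H1. auto.
  - intros t t' u _ H s. simpl. rewrite H. tauto.
  - intros t u u' _ H s. simpl. rewrite H. tauto.
  - intros t t' u _ H s. simpl. rewrite H. tauto.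
  - intros t u u' E H s. simpl. rewrite H, (usub_equiv E). tauto.
Qed.

(** The swap is an involution, so the commutation axiom read backwards is an instance of itself, and
    one direction is enough to check. *)
Lemma ren_swap_swap (K : Type) (t : term K) : ren swap01 (ren swap01 t) = t.
Proof. rewrite ren_ren. apply ren_id. cases_nat. Qed.

(** In the nesting axiom [w] is an entry of the list on one side only; [fireball_es] supplies its
    fireball condition for that side. *)
Lemma answer_equiv (K : Type) (t u : term K) : equiv t u ->
  forall s, fireball_es s t -> (answer s t <-> answer s u).
Proof.
  revert t u. apply (@equiv_closed K (fun t u =>
    forall s, fireball_es s t -> (answer s t <-> answer s u))).
  - intros t u [t0 u0 w|t0 w u0|t0 w u0|t0 u0 w] s; simpl; try tauto;
      rewrite ?usub_es, ?usub_shift.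
    + rewrite (@answer_ren _ t0 swap01 _
        (scons (usub s u0) (scons (usub s w) s))) by cases_nat. tauto.
    + rewrite (@answer_ren _ t0 (upr S) _
        (scons (usub (scons (usub s w) s) u0) s)) by cases_nat. tauto.
  - tauto.
  - intros t u E H s Hu. symmetry. apply H. apply (fireball_es_equiv E), Hu.
  - intros t u w E _ H1 H2 s Ht. rewrite (H1 s Ht). apply H2.
    apply (fireball_es_equiv E), Ht.
  - simpl; tauto.
  - simpl; tauto.
  - intros t t' u _ H s (H1 & H2 & H3). simpl. rewrite (H _ H3). tauto.
  - intros t u u' E _ s _. simpl. rewrite (usub_equiv E). tauto.
Qed.

(** The result of floating the explicit substitutions of a term can be a
    redex only if the remaining term is an abstraction or a variable; these do
    not interact with the axioms about applications. *)
Fixpoint headed (K : Type) (t : term K) : Prop :=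
  match t with
  | Var _ | Lam _ => True
  | Es t _ => headed t
  | _ => False
  end.

Lemma headed_ren (K : Type) (t : term K) : forall r, headed (ren r t) <-> headed t.
Proof. induction t; simpl; intuition; apply (IHt1 (upr r)); auto. Qed.

Lemma answer_headed (K : Type) (t : term K) : forall s, answer s t -> headed t.
Proof. induction t; simpl; intuition eauto. Qed.

Lemma value_headed (K : Type) (t : term K) : forall s, value (usub s t) -> headed t.
Proof.
  induction t; simpl; auto; intros s H.
  - destruct H; discriminate.
  - destruct H; discriminate.
  - rewrite usub_es in H. eauto.
Qed.

Lemma equiv_es_com (K : Type) (t t' u u' w w' : term K) :
  t' = ren swap01 t -> u' = ren S u -> w' = ren S w ->
  equiv (Es (Es t u') w) (Es (Es t' w') u).
Proof. intros -> -> ->. apply equiv_in_ax, ax_com. Qed.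

Lemma equiv_es_nest (K : Type) (t t' u w : term K) :
  t' = ren (upr S) t -> equiv (Es (Es t' u) w) (Es t (Es u w)).
Proof. intros ->. apply equiv_in_ax, ax_nest. Qed.

Lemma headed_equiv (K : Type) (t u : term K) : equiv t u -> (headed t <-> headed u).
Proof.
  revert t u. apply (@equiv_closed K (fun t u => headed t <-> headed u)); simpl; try tauto.
  intros t u []; simpl; rewrite ?headed_ren; tauto.
Qed.

Lemma beta_equiv (K : Type) (t u : term K) : equiv t u ->
  headed t -> forall w, equiv (beta t w) (beta u w).
Proof.
  revert t u. apply (@equiv_closed K (fun t u =>
    headed t -> forall w, equiv (beta t w) (beta u w))); simpl; try tauto.
  - intros t u [t0 u0 w0|t0 w0 u0|t0 w0 u0|t0 u0 w0]; simpl; try tauto; intros _ w.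
    + apply equiv_es_com; auto. rewrite ren_beta. f_equal. ren_eq.
    + apply equiv_es_nest. rewrite ren_beta. f_equal. ren_eq.
  - auto using equiv_refl.
  - intros t u E H Hu w. apply equiv_sym, H. apply (headed_equiv E), Hu.
  - intros t u v E _ H1 H2 Ht w. eapply equiv_trans; [apply H1, Ht|].
    apply H2. apply (headed_equiv E), Ht.
  - auto using equiv_esl.
  - auto using equiv_esr.
Qed.

Lemma beta_equiv_arg (K : Type) (t : term K) : forall u w,
  equiv u w -> equiv (beta t u) (beta t w).
Proof.
  induction t; simpl; intros u w H; auto using equiv_appr, equiv_esr.
  apply equiv_esl. apply IHt1, equiv_ren, H.
Qed.

Lemma dup_equiv (K : Type) (t u : term K) : equiv t u ->
  headed t -> forall C, equiv (dup C t) (dup C u).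
Proof.
  revert t u. apply (@equiv_closed K (fun t u =>
    headed t -> forall C, equiv (dup C t) (dup C u))); simpl; try tauto.
  - intros t u [t0 u0 w0|t0 w0 u0|t0 w0 u0|t0 u0 w0]; simpl; try tauto; intros _ C.
    + apply equiv_es_com; auto. rewrite ren_dup. f_equal. ren_eq.
    + apply equiv_es_nest. rewrite ren_dup. f_equal. ren_eq.
  - auto using equiv_refl.
  - intros t u E H Hu C. apply equiv_sym, H. apply (headed_equiv E), Hu.
  - intros t u v E _ H1 H2 Ht C. eapply equiv_trans; [apply H1, Ht|].
    apply H2. apply (headed_equiv E), Ht.
  - auto using equiv_esl.
  - auto using equiv_esr.
Qed.

(** Quantified over renamings because [dup] renames the context at each explicit substitution it
    crosses. *)
Definition ctx_equiv (K : Type) (C D : sctx K) : Prop :=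
  forall r v, equiv (fill (ren_ctx r C) v) (fill (ren_ctx r D) v).

Lemma ctx_equiv_ren (K : Type) (C D : sctx K) r :
  ctx_equiv C D -> ctx_equiv (ren_ctx r C) (ren_ctx r D).
Proof. intros H r' v. rewrite !ren_ctx_ren_ctx. apply H. Qed.

Lemma dup_ctx_equiv (K : Type) (w : term K) : forall C D,
  ctx_equiv C D -> equiv (dup C w) (dup D w).
Proof.
  assert (B : forall (C D : sctx K) v, ctx_equiv C D -> equiv (fill C v) (fill D v)).
  { intros C D v H. specialize (H (fun n => n) v).
    rewrite !ren_ctx_id in H; auto. }
  induction w; intros C D H; try (apply equiv_esl, B, H).
  simpl. apply equiv_esl, IHw1, ctx_equiv_ren, H.
Qed.

Lemma equiv_refl_eq (K : Type) (t u : term K) : t = u -> equiv t u.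
Proof. intros ->. apply equiv_refl. Qed.

(** ** Floating the axioms through the redexes *)

(** Firing the redex turns the application axiom into nesting, since the argument becomes the body
    of the new substitution; the entries in front of the abstraction are commuted past [u]. *)
Lemma beta_appr (K : Type) (t : term K) : forall w u, headed t ->
  equiv (Es (beta (ren S t) w) u) (beta t (Es w u)).
Proof.
  induction t; simpl; intros w u H; try tauto.
  - apply equiv_in_ax. apply (ax_appr (Var n)).
  - apply equiv_es_nest. reflexivity.
  - eapply equiv_trans; [|apply equiv_esl, (IHt1 (ren (upr S) w) (ren S u)), H].
    apply equiv_es_com; auto. rewrite ren_beta. f_equal; ren_eq.
Qed.

(** Commuting two explicit substitutions changes the role of [w]: it encloses the duplication on one
    side and belongs to the context of the replaced occurrence on the other. Each entry around the
    copied term is commuted past it. *)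
Lemma dup_com (K : Type) (u : term K) : forall C w, headed u ->
  equiv (Es (dup C (ren S u)) w) (dup (SEs (ren_ctx swap01 C) (ren S w)) u).
Proof.
  assert (B : forall C (v w : term K), equiv
    (Es (Es (fill C (ren S (ren S v))) (ren S v)) w)
    (Es (Es (fill (ren_ctx swap01 C) (ren S (ren S v))) (ren S w)) v)).
  { intros C v w. apply equiv_es_com; auto. rewrite ren_fill. f_equal. ren_eq. }
  induction u as [n|a|t IH|t1 IH1 t2 IH2|u1 IHu1 u2 IHu2]; intros C w H; try destruct H.
  1: exact (B C (Var n) w).
  1: exact (B C (Lam t) w).
  simpl in *.
  eapply equiv_trans.
  - apply equiv_es_com; [rewrite ren_dup; reflexivity | reflexivity | reflexivity].
  - apply equiv_esl.
    match goal with |- equiv _ (dup (SEs ?C1 ?w1) _) =>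
      replace (SEs C1 w1) with
        (SEs (ren_ctx swap01 (ren_ctx (upr (upr S)) C)) (ren S (ren S w))) end.
    + eapply equiv_trans; [|apply IHu1, H].
      apply equiv_refl_eq. f_equal. f_equal; ren_eq.
    + f_equal; ren_eq.
Qed.

Lemma dup_appr (K : Type) (u t : term K) : forall C, headed u ->
  equiv (dup (SAppR (ren S t) C) u) (App t (dup C u)).
Proof.
  revert t. induction u; intros t C H; try destruct H;
    try (apply equiv_in_ax, ax_appr).
  simpl in *. eapply equiv_trans; [|apply equiv_in_ax, ax_appr].
  rewrite ren_upr_shift. apply equiv_esl, IHu1, H.
Qed.

Lemma dup_appl (K : Type) (u t : term K) : forall C, headed u ->
  equiv (dup (SAppL C (ren S t)) u) (App (dup C u) t).
Proof.
  revert t. induction u; intros t C H; try destruct H;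
    try (apply equiv_in_ax, ax_appl).
  simpl in *. eapply equiv_trans; [|apply equiv_in_ax, ax_appl].
  rewrite ren_upr_shift. apply equiv_esl, IHu1, H.
Qed.

(** ** Strong bisimulation *)

(** Needed when an equivalence step happens in the body [t] of a redex [Es t w]: the replaceable
    occurrence must reappear, still evaluable, in a context that gives equivalent reducts. *)
Definition occ_sim (K : Type) (t u : term K) : Prop :=
  forall b s x C, fireball_es s t -> t = fill C (Var x) -> ev b s C ->
  exists D, u = fill D (Var x) /\ ev b s D /\ ctx_equiv C D.

Lemma ctx_equiv_refl (K : Type) (C : sctx K) : ctx_equiv C C.
Proof. intros r v. apply equiv_refl. Qed.

Lemma occ_sim_com (K : Type) (t u w : term K) :
  occ_sim (Es (Es t (ren S u)) w) (Es (Es (ren swap01 t) (ren S w)) u).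
Proof.
  intros b s x C _ H E.
  destruct C as [| | |[| | |C u'] w']; simpl in H; inversion H; subst.
  exists (SEs (SEs (ren_ctx swap01 C) (ren S w')) u). simpl in *.
  rewrite usub_shift in *. rewrite ren_fill. repeat split; try tauto.
  - eapply ev_ren; [|apply E]. cases_nat.
  - intros r v. simpl. apply equiv_es_com; try ren_eq.
    rewrite ren_fill. f_equal; ren_eq.
Qed.

Lemma occ_sim_ax (K : Type) (t u : term K) :
  equiv_ax t u -> occ_sim t u /\ occ_sim u t.
Proof.
  intros [t0 u0 w|t0 w u0|t0 w u0|t0 u0 w].
  - split; [apply occ_sim_com|].
    rewrite <- (ren_swap_swap t0) at 2. apply occ_sim_com.
  - split; intros b s x C I H E.
    + destruct C as [| | |[|C w'|t' C|] u']; simpl in H; inversion H; subst; simpl in *.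
      * symmetry in H1. apply fill_var_ren_inv in H1.
        destruct H1 as (C' & y & -> & -> & Hy). inversion Hy; subst y.
        exists (SAppL C' (Es w' u')). simpl. rewrite usub_es.
        repeat split; try tauto.
        -- eapply ev_ren; [|apply E]. reflexivity.
        -- intros r v. simpl. rewrite ren_ctx_ren_ctx.
           eapply equiv_trans; [|apply equiv_in_ax, ax_appr]. apply equiv_refl_eq.
           rewrite ren_fill, ren_ctx_ren_ctx. reflexivity.
      * exists (SAppR t0 (SEs C u')). simpl. repeat split; try tauto.
        intros r v. simpl. eapply equiv_trans; [|apply equiv_in_ax, ax_appr].
        apply equiv_refl_eq. rewrite ren_upr_shift. reflexivity.
    + destruct C as [|C w'|t' [| | |C u'] |]; simpl in H; inversion H; subst; simpl in *.
      * exists (SEs (SAppL (ren_ctx S C) w) u0). simpl. rewrite <- usub_es.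
        rewrite ren_fill. repeat split; try tauto.
        -- eapply ev_ren; [|apply E]. reflexivity.
        -- intros r v. simpl. eapply equiv_trans; [apply equiv_sym, equiv_in_ax, ax_appr|].
           apply equiv_refl_eq. rewrite ren_fill, !ren_ctx_ren_ctx. reflexivity.
      * exists (SEs (SAppR (ren S t') C) u'). simpl. repeat split; try tauto.
        intros r v. simpl. eapply equiv_trans; [apply equiv_sym, equiv_in_ax, ax_appr|].
        apply equiv_refl_eq. rewrite ren_upr_shift. reflexivity.
  - split; intros b s x C I H E.
    + destruct C as [| | |[|C w'|t' C|] u']; simpl in H; inversion H; subst; simpl in *.
      * rewrite usub_shift in E. exists (SAppL (SEs C u') w). simpl.
        repeat split; try tauto.
        intros r v. simpl. eapply equiv_trans; [|apply equiv_in_ax, ax_appl].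
        apply equiv_refl_eq. rewrite ren_upr_shift. reflexivity.
      * symmetry in H2. apply fill_var_ren_inv in H2.
        destruct H2 as (C' & y & -> & -> & Hy). inversion Hy; subst y.
        exists (SAppR (Es t' u') C'). simpl. repeat split; try tauto.
        -- eapply ev_ren; [|apply E]. reflexivity.
        -- intros r v. simpl. rewrite ren_ctx_ren_ctx.
           eapply equiv_trans; [|apply equiv_in_ax, ax_appl]. apply equiv_refl_eq.
           rewrite ren_fill, ren_ctx_ren_ctx. reflexivity.
    + destruct C as [|[| | |C u'] w'|t' C|]; simpl in H; inversion H; subst; simpl in *.
      * exists (SEs (SAppL C (ren S w')) u'). simpl. rewrite usub_shift.
        repeat split; try tauto.
        intros r v. simpl. eapply equiv_trans; [apply equiv_sym, equiv_in_ax, ax_appl|].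
        apply equiv_refl_eq. rewrite ren_upr_shift. reflexivity.
      * exists (SEs (SAppR t0 (ren_ctx S C)) u0). simpl.
        rewrite ren_fill. repeat split; try tauto.
        -- eapply ev_ren; [|apply E]. reflexivity.
        -- intros r v. simpl. eapply equiv_trans; [apply equiv_sym, equiv_in_ax, ax_appl|].
           apply equiv_refl_eq. rewrite ren_fill, !ren_ctx_ren_ctx. reflexivity.
  - split; intros b s x C I H E.
    + destruct C as [| | |[| | |C u'] w']; simpl in H; inversion H; subst; simpl in *.
      symmetry in H1. apply fill_var_ren_inv in H1.
      destruct H1 as (C' & [|y] & -> & -> & Hy); inversion Hy; subst.
      exists (SEs C' (Es u' w')). simpl. rewrite usub_es.
      repeat split; try tauto.
      * eapply ev_ren; [|apply E]. cases_nat.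
      * intros r v. simpl. apply equiv_es_nest.
        rewrite ren_fill. f_equal; ren_eq.
    + destruct C as [| | |C w']; simpl in H; inversion H; subst; simpl in *.
      rewrite usub_es in *. exists (SEs (SEs (ren_ctx (upr S) C) u0) w). simpl.
      rewrite ren_fill. repeat split; try tauto.
      * eapply ev_ren; [|apply E]. cases_nat.
      * intros r v. simpl. apply equiv_sym, equiv_es_nest.
        rewrite ren_fill. f_equal; ren_eq.
Qed.

Lemma occ_sim_equiv (K : Type) (t u : term K) :
  equiv t u -> occ_sim t u /\ occ_sim u t.
Proof.
  assert (T : forall t u w : term K, equiv t u -> occ_sim t u -> occ_sim u w -> occ_sim t w).
  { intros t0 u0 w E H1 H2 b s x C I H EC.
    destruct (H1 b s x C I H EC) as (D & HD & ED & Q).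
    destruct (H2 b s x D) as (D' & HD' & ED' & Q'); auto.
    - apply (fireball_es_equiv E), I.
    - exists D'. repeat split; auto. intros r v. eapply equiv_trans; eauto. }
  assert (AL : forall t t' u : term K, equiv t t' -> occ_sim t t' ->
            occ_sim (App t u) (App t' u)).
  { intros t0 t' w E Q b s x [|C w'|t1 C|] I H EC; simpl in H; inversion H; subst.
    - destruct (Q true s x C) as (D & HD & ED & W); try apply I; try apply EC; auto.
      exists (SAppL D w'). simpl in *. subst t'. repeat split; try tauto.
      intros r v. simpl. apply equiv_appl, W.
    - exists (SAppR t' C). simpl in *. repeat split; auto.
      intros r v. simpl. apply equiv_appl, equiv_ren, E. }
  assert (AR : forall t u u' : term K, equiv u u' -> occ_sim u u' ->
            occ_sim (App t u) (App t u')).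
  { intros t0 w w' E Q b s x [|C w1|t1 C|] I H EC; simpl in H; inversion H; subst.
    - exists (SAppL C w'). simpl in *. rewrite <- (usub_equiv E). repeat split; try tauto.
      intros r v. simpl. apply equiv_appr, equiv_ren, E.
    - destruct (Q false s x C) as (D & HD & ED & W); try apply I; try apply EC; auto.
      exists (SAppR t1 D). simpl in *. subst w'. repeat split; try tauto.
      intros r v. simpl. apply equiv_appr, W. }
  assert (EL : forall t t' u : term K, equiv t t' -> occ_sim t t' ->
            occ_sim (Es t u) (Es t' u)).
  { intros t0 t' w E Q b s x [| | |C w'] I H EC; simpl in H; inversion H; subst.
    destruct (Q b (scons (usub s w') s) (S x) C) as (D & HD & ED & W);
      try apply I; try apply EC; auto.
    exists (SEs D w'). simpl in *. subst t'. repeat split; try tauto.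
    intros r v. simpl. apply equiv_esl, W. }
  assert (ER : forall t u u' : term K, equiv u u' -> occ_sim (Es t u) (Es t u')).
  { intros t0 w w' E b s x [| | |C w1] I H EC; simpl in H; inversion H; subst.
    exists (SEs C w'). simpl in *. rewrite <- (usub_equiv E). repeat split; try tauto.
    intros r v. simpl. apply equiv_esr, equiv_ren, E. }
  revert t u. apply (@equiv_closed K (fun t u => occ_sim t u /\ occ_sim u t)).
  - apply occ_sim_ax.
  - intros t. assert (occ_sim t t); auto. intros b s x C _ -> E.
    exists C. auto using ctx_equiv_refl.
  - tauto.
  - intros t u w E1 E2 [] []. split; [apply (T _ u) | apply (T _ u)]; auto using equiv_sym.
  - intros t t' u E []. split; apply AL; auto using equiv_sym.
  - intros t u u' E []. split; apply AR; auto using equiv_sym.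
  - intros t t' u E []. split; apply EL; auto using equiv_sym.
  - intros t u u' E _. split; apply ER; auto using equiv_sym.
Qed.

Definition red_sim (K : Type) (t u : term K) : Prop :=
  forall r b s t', fireball_es s t -> redS r b s t t' ->
  exists u', redS r b s u u' /\ equiv t' u'.

(** Firing the outer substitution corresponds to firing the inner one of the commuted term, and
    conversely; both cases reduce to [dup_com]. *)
Lemma red_sim_com (K : Type) (t u w : term K) :
  red_sim (Es (Es t (ren S u)) w) (Es (Es (ren swap01 t) (ren S w)) u).
Proof.
  intros r b s t' I R. simpl in I. rewrite usub_shift in I.
  inversion R; subst.
  - match goal with H : Es _ _ = fill _ _ |- _ =>
      destruct C as [| | |C u']; simpl in H; inversion H; subst end.
    simpl in *. rewrite usub_shift in *.
    exists (Es (dup (ren_ctx swap01 C) (ren S w)) u). split.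
    + apply redS_es; [tauto|]. apply redS_ue; rewrite ?usub_shift; auto.
      * rewrite ren_fill. reflexivity.
      * match goal with H : _ /\ ev _ _ _ |- _ => eapply ev_ren; [|apply H] end. cases_nat.
    + eapply equiv_sym. eapply equiv_trans; [apply dup_com; eapply value_headed; eauto|].
      apply equiv_refl_eq. f_equal. f_equal. rewrite ren_ctx_ren_ctx.
      apply ren_ctx_id. cases_nat.
  - match goal with H : redS _ _ _ (Es _ _) _ |- _ => inversion H; subst end;
      rewrite usub_shift in *.
    + exists (dup (SEs (ren_ctx swap01 C) (ren S w)) u). split.
      * apply redS_ue; auto.
        -- simpl. rewrite ren_fill. reflexivity.
        -- simpl. rewrite usub_shift. split; auto.
           eapply ev_ren; [|eassumption]. cases_nat.
      * apply dup_com. eapply value_headed; eauto.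
    + match goal with H : redS _ _ _ t ?t' |- _ =>
        exists (Es (Es (ren swap01 t') (ren S w)) u) end. split.
      * apply redS_es; auto. apply redS_es; rewrite ?usub_shift; auto.
        eapply redS_ren; [eassumption|]. cases_nat.
      * apply equiv_in_ax, ax_com.
Qed.

Ltac inv_redS :=
  match goal with
  | H : redS _ _ _ (Es _ _) _ |- _ => inversion H; subst; clear H
  | H : redS _ _ _ (App _ _) _ |- _ => inversion H; subst; clear H
  end.

Ltac inv_fill :=
  match goal with
  | H : Es _ _ = fill ?C _ |- _ =>
      destruct C as [| | |C ?]; simpl in H; inversion H; subst; clear H
  | H : App _ _ = fill ?C _ |- _ =>
      destruct C as [|C ?|? C|]; simpl in H; inversion H; subst; clear H
  | H : ren ?r _ = fill ?C _ |- _ =>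
      let C' := fresh "C" in let y := fresh "y" in let Hy := fresh "Hy" in
      symmetry in H; apply fill_var_ren_inv in H;
      destruct H as (C' & [|y] & ? & ? & Hy); simpl in Hy; inversion Hy; subst; clear Hy
  end.

Ltac inv_redS_ren s :=
  match goal with
  | H : redS _ _ _ (ren _ _) _ |- _ =>
      apply (redS_ren_inv _ _ s) in H; [|cases_nat];
      let t0 := fresh "t0" in destruct H as (t0 & -> & ?)
  end.

Lemma red_sim_appr (K : Type) (t w u : term K) :
  red_sim (Es (App (ren S t) w) u) (App t (Es w u)).
Proof.
  intros r b s t' I R. simpl in I. rewrite fireball_es_shift in I.
  inv_redS; [inv_fill|inv_redS]; simpl in *; rewrite ?usub_shift in *.
  (* [0] is not in the image of [S], so the bound variable has no occurrence in [ren S t]. *)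
  - inv_fill.
  - eexists. split.
    + apply redS_appr, redS_ue; eauto.
    + apply dup_appr. eapply value_headed; eauto.
  - rewrite answer_ren in H5 by reflexivity. eexists. split.
    + apply redS_um; [eassumption|]. rewrite usub_es. assumption.
    + apply beta_appr. eapply answer_headed; eauto.
  - inv_redS_ren s.
    exists (App t0 (Es w u)). split.
    + apply redS_appl; rewrite ?usub_es; auto.
    + apply equiv_in_ax, ax_appr.
  - eexists. split.
    + apply redS_appr, redS_es; eassumption.
    + apply equiv_in_ax, ax_appr.
Qed.

Lemma red_sim_appr' (K : Type) (t w u : term K) :
  red_sim (App t (Es w u)) (Es (App (ren S t) w) u).
Proof.
  intros r b s t' I R. simpl in I.
  inv_redS; rewrite ?usub_es in *.
  - eexists. split.
    + apply redS_es; [tauto|]. apply redS_um; [|eassumption].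
      eapply answer_ren; [|eassumption]. reflexivity.
    + apply equiv_sym, beta_appr. eapply answer_headed; eauto.
  - eexists. split.
    + apply redS_es; [tauto|]. apply redS_appl; [|eassumption].
      eapply redS_ren; [eassumption|]. reflexivity.
    + apply equiv_sym, equiv_in_ax, ax_appr.
  - inv_redS.
    + eexists. split.
      * apply redS_ue with (C := SAppR (ren S t) C); simpl; eauto.
      * apply equiv_sym, dup_appr. eapply value_headed; eauto.
    + eexists. split.
      * apply redS_es; [tauto|]. apply redS_appr; eassumption.
      * apply equiv_sym, equiv_in_ax, ax_appr.
Qed.

Lemma red_sim_appl (K : Type) (t w u : term K) :
  red_sim (Es (App t (ren S w)) u) (App (Es t u) w).
Proof.
  intros r b s t' I R. simpl in I. rewrite fireball_es_shift in I.
  inv_redS; [inv_fill|inv_redS]; simpl in *; rewrite ?usub_shift in *.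
  - eexists. split.
    + apply redS_appl; [|tauto]. apply redS_ue; intuition eauto.
    + apply dup_appl. eapply value_headed; eauto.
  - inv_fill.
  - eexists. split.
    + apply redS_um; simpl; auto.
    (* [beta] itself moves the substitution out of the application, so the two reducts are equal. *)
    + simpl. apply equiv_refl.
  - eexists. split.
    + apply redS_appl; [|eassumption]. apply redS_es; eauto.
    + apply equiv_in_ax, ax_appl.
  - inv_redS_ren s.
    exists (App (Es t u) t0). split.
    + apply redS_appr; auto.
    + apply equiv_in_ax, ax_appl.
Qed.

Lemma red_sim_appl' (K : Type) (t w u : term K) :
  red_sim (App (Es t u) w) (Es (App t (ren S w)) u).
Proof.
  intros r b s t' I R. simpl in I.
  inv_redS; [| inv_redS |]; simpl in *.
  - eexists. split.
    + apply redS_es; [tauto|]. apply redS_um; rewrite ?usub_shift; tauto.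
    + simpl. apply equiv_refl.
  - eexists. split.
    + apply redS_ue with (C := SAppL C (ren S w)); simpl; rewrite ?usub_shift; eauto.
    + apply equiv_sym, dup_appl. eapply value_headed; eauto.
  - eexists. split.
    + apply redS_es; [tauto|]. apply redS_appl; rewrite ?usub_shift; eauto.
    + apply equiv_sym, equiv_in_ax, ax_appl.
  - eexists. split.
    + apply redS_es; [tauto|]. apply redS_appr. eapply redS_ren; [eassumption|]. reflexivity.
    + apply equiv_sym, equiv_in_ax, ax_appl.
Qed.

Lemma red_sim_nest (K : Type) (t u w : term K) :
  red_sim (Es (Es (ren (upr S) t) u) w) (Es t (Es u w)).
Proof.
  intros r b s t' I R. simpl in I.
  inv_redS; [inv_fill|inv_redS]; simpl in *.
  - inv_fill.
  - inv_fill. eexists. split.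
    + apply redS_ue; rewrite ?usub_es; eauto. eapply ev_ren; [|eassumption]. cases_nat.
    + simpl. apply equiv_refl.
  - inv_redS_ren (scons (usub (scons (usub s w) s) u) s). exists (Es t0 (Es u w)). split.
    + apply redS_es; rewrite ?usub_es; auto.
    + apply equiv_in_ax, ax_nest.
Qed.

Lemma red_sim_nest' (K : Type) (t u w : term K) :
  red_sim (Es t (Es u w)) (Es (Es (ren (upr S) t) u) w).
Proof.
  intros r b s t' I R. simpl in I. rewrite usub_es in I.
  inv_redS; simpl in *; rewrite ?usub_es in *.
  - eexists. split.
    + apply redS_es; [tauto|]. apply redS_ue with (C := ren_ctx (upr S) C); auto.
      * rewrite ren_fill. reflexivity.
      * eapply ev_ren; [|eassumption]. cases_nat.
    + apply equiv_refl.
  - eexists. split.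
    + apply redS_es; [tauto|]. apply redS_es; [tauto|].
      eapply redS_ren; [eassumption|]. cases_nat.
    + apply equiv_sym, equiv_in_ax, ax_nest.
Qed.

Lemma red_sim_ax (K : Type) (t u : term K) :
  equiv_ax t u -> red_sim t u /\ red_sim u t.
Proof.
  intros [t0 u0 w|t0 w u0|t0 w u0|t0 u0 w]; split;
    auto using red_sim_com, red_sim_appr, red_sim_appr', red_sim_appl, red_sim_appl',
      red_sim_nest, red_sim_nest'.
  rewrite <- (ren_swap_swap t0) at 2. apply red_sim_com.
Qed.

(** Besides the axioms, the critical cases are equivalence steps inside a redex: in its function
    ([beta_equiv]), its argument ([beta_equiv_arg]), the body holding the occurrence
    ([occ_sim_equiv]) or the substituted term ([dup_equiv]). *)
Lemma red_sim_equiv (K : Type) (t u : term K) :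
  equiv t u -> red_sim t u /\ red_sim u t.
Proof.
  assert (T : forall t u w : term K, equiv t u -> red_sim t u -> red_sim u w -> red_sim t w).
  { intros t0 u0 w E H1 H2 r b s t' I R.
    destruct (H1 r b s t' I R) as (u' & R' & Q).
    destruct (H2 r b s u') as (w' & R'' & Q'); auto.
    - apply (fireball_es_equiv E), I.
    - exists w'. eauto using equiv_trans. }
  assert (AL : forall t t' u : term K, equiv t t' -> red_sim t t' ->
            red_sim (App t u) (App t' u)).
  { intros t0 t' w E Q r b s x I R. simpl in I. inv_redS.
    - eexists. split.
      + apply redS_um; [|eassumption]. apply (answer_equiv E); [apply I | eassumption].
      + apply beta_equiv; auto. eapply answer_headed; eauto.
    - edestruct Q as (v' & R' & Q'); [apply I | eassumption |].
      exists (App v' w). split; [apply redS_appl; auto | apply equiv_appl, Q'].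
    - eexists. split; [apply redS_appr; eassumption | apply equiv_appl, E]. }
  assert (AR : forall t u u' : term K, equiv u u' -> red_sim u u' ->
            red_sim (App t u) (App t u')).
  { intros t0 w w' E Q r b s x I R. simpl in I. inv_redS; rewrite ?(usub_equiv E) in *.
    - eexists. split; [apply redS_um; eassumption | apply beta_equiv_arg, E].
    - eexists. split; [apply redS_appl; eassumption | apply equiv_appr, E].
    - edestruct Q as (v' & R' & Q'); [apply I | eassumption |].
      exists (App t0 v'). split; [apply redS_appr; auto | apply equiv_appr, Q']. }
  assert (EL : forall t t' u : term K, equiv t t' -> red_sim t t' ->
            red_sim (Es t u) (Es t' u)).
  { intros t0 t' w E Q r b s x I R. simpl in I. inv_redS.
    - destruct (proj1 (occ_sim_equiv E) b (scons (usub s w) s) 0 C) as (D & -> & ED & W);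
        try apply I; auto.
      exists (dup D w). split; [apply redS_ue; auto | apply dup_ctx_equiv, W].
    - edestruct Q as (v' & R' & Q'); [apply I | eassumption |].
      exists (Es v' w). split; [apply redS_es; auto | apply equiv_esl, Q']. }
  assert (ER : forall t u u' : term K, equiv u u' -> red_sim (Es t u) (Es t u')).
  { intros t0 w w' E r b s x I R. simpl in I. inv_redS.
    - match goal with H : value _ |- _ => pose proof (value_headed _ _ H) end.
      rewrite (usub_equiv E) in *.
      eexists. split; [apply redS_ue; eauto | apply dup_equiv; auto].
    - rewrite (usub_equiv E) in *.
      eexists. split; [apply redS_es; eauto | apply equiv_esr, E]. }
  revert t u. apply (@equiv_closed K (fun t u => red_sim t u /\ red_sim u t)).
  - apply red_sim_ax.
  - intros t. assert (red_sim t t); auto. intros r b s t' _ R. eauto using equiv_refl.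
  - tauto.
  - intros t u w E1 E2 [] []. split; [apply (T _ u) | apply (T _ u)]; auto using equiv_sym.
  - intros t t' u E []. split; apply AL; auto using equiv_sym.
  - intros t u u' E []. split; apply AR; auto using equiv_sym.
  - intros t t' u E []. split; apply EL; auto using equiv_sym.
  - intros t u u' E _. split; apply ER; auto using equiv_sym.
Qed.

Lemma generated_fireball_es (K : Type) (t : term K) :
  generated (@uf K) (@equiv K) t -> fireball_es Var t.
Proof.
  induction 1 as [t H | r t u _ IH H | t u _ IH H].
  - apply fireball_es_lambda, H.
  - eapply fireball_es_redS; [apply uf_redS, H | exact IH].
  - apply (fireball_es_equiv H), IH.
Qed.

(** * The machine on nameless states *)

Scheme item_mut := Induction for item Sort Prop
  with stack_mut := Induction for stack Sort Prop.
Combined Scheme item_stack_ind from item_mut, stack_mut.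

Fixpoint item_all (C : Type) (P : C -> Prop) (phi : item C) : Prop :=
  match phi with
  | ICode t => P t
  | IPair t p => P t /\ stack_all P p
  end
with stack_all (C : Type) (P : C -> Prop) (p : stack C) : Prop :=
  match p with
  | SNil => True
  | SCons phi _ p => item_all P phi /\ stack_all P p
  end.

Definition dump_all (C : Type) (P : C -> Prop) (D : dump C) : Prop :=
  Forall (fun c => P (fst c) /\ stack_all P (snd c)) D.

Lemma map_item_stack_ext (C C' : Type) (P : C -> Prop) (f g : C -> C') :
  (forall c, P c -> f c = g c) ->
  (forall phi, item_all P phi -> map_item f phi = map_item g phi) /\
  (forall p, stack_all P p -> map_stack f p = map_stack g p).
Proof.
  intros H. apply item_stack_ind; simpl; intros; f_equal; intuition.
Qed.

Lemma map_item_stack_map (A B C : Type) (f : A -> B) (g : B -> C) :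
  (forall phi, map_item g (map_item f phi) = map_item (fun a => g (f a)) phi) /\
  (forall p, map_stack g (map_stack f p) = map_stack (fun a => g (f a)) p).
Proof. apply item_stack_ind; simpl; intros; f_equal; auto. Qed.

Lemma item_stack_all_map (C C' : Type) (P : C' -> Prop) (Q : C -> Prop) (f : C -> C') :
  (forall c, P (f c) <-> Q c) ->
  (forall phi, item_all P (map_item f phi) <-> item_all Q phi) /\
  (forall p, stack_all P (map_stack f p) <-> stack_all Q p).
Proof. intros H. apply item_stack_ind; simpl; intros; firstorder. Qed.

Lemma item_stack_all_impl (C : Type) (P Q : C -> Prop) :
  (forall c, P c -> Q c) ->
  (forall phi, item_all P phi -> item_all Q phi) /\
  (forall p, stack_all P p -> stack_all Q p).
Proof. intros H. apply item_stack_ind; simpl; intros; intuition. Qed.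

(** An entry is scoped in the part of the environment behind it, so copying entry [n] shifts by
    [S n]; a new entry in front shifts dump and stack by one. *)
Inductive nstep (K : Type) : glabel -> nstate K -> nstate K -> Prop :=
| nstep_c1 D t u p E :
    nstep c1 (NSt D (App t u) p E) (NSt ((t, p) :: D) u SNil E)
| nstep_um D t phi l p E :
    nstep lum (NSt D (Lam t) (SCons phi l p) E)
      (NSt (map_dump (ren S) D) t (map_stack (ren S) p) ((phi, l) :: E))
| nstep_c2 D t p u E :
    nstep c2 (NSt ((t, p) :: D) (Lam u) SNil E)
      (NSt D t (SCons (ICode (Lam u)) tagV p) E)
| nstep_c3 D t p a p' E :
    nstep c3 (NSt ((t, p) :: D) (Cst a) p' E)
      (NSt D t (SCons (IPair (Cst a) p') tagA p) E)
| nstep_c4 D t p n p' E phi :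
    nth_error E n = Some (phi, tagA) ->
    nstep c4 (NSt ((t, p) :: D) (Var n) p' E)
      (NSt D t (SCons (IPair (Var n) p') tagA p) E)
| nstep_c5 D t p n E u :
    nth_error E n = Some (ICode u, tagV) ->
    nstep c5 (NSt ((t, p) :: D) (Var n) SNil E)
      (NSt D t (SCons (ICode (Var n)) tagV p) E)
| nstep_ue D n phi l p E u :
    nth_error E n = Some (ICode u, tagV) ->
    nstep lue (NSt D (Var n) (SCons phi l p) E)
      (NSt D (ren (Nat.add (S n)) u) (SCons phi l p) E).

Lemma nstep_deterministic (K : Type) l (m m1 m2 : nstate K) :
  nstep l m m1 -> nstep l m m2 -> m1 = m2.
Proof. destruct 1; inversion 1; congruence. Qed.

(** ** Scoping *)

Lemma closed_at_ren (K : Type) (t : term K) : forall k k' r,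
  (forall n, n < k -> r n < k') -> closed_at k t -> closed_at k' (ren r t).
Proof.
  assert (U : forall k k' r, (forall n, n < k -> r n < k') ->
            forall n, n < S k -> upr r n < S k').
  { intros k k' r H [|n] Hn; simpl; [lia|]. specialize (H n). lia. }
  induction t; simpl; intros k k' r H; intuition eauto.
Qed.

Lemma closed_at_shift (K : Type) (t : term K) k :
  closed_at k t -> closed_at (S k) (ren S t).
Proof. apply closed_at_ren. intros; lia. Qed.

Fixpoint env_scoped (K : Type) (E : list (item (term K) * tag)) : Prop :=
  match E with
  | [] => True
  | (phi, _) :: E => item_all (closed_at (length E)) phi /\ env_scoped E
  end.

Definition scoped (K : Type) (m : nstate K) : Prop :=
  let P := closed_at (length (nst_env m)) in
  dump_all P (nst_dump m) /\ P (nst_term m) /\ stack_all P (nst_stack m) /\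
  env_scoped (nst_env m).

Lemma env_scoped_nth (K : Type) (E : list (item (term K) * tag)) : forall n phi l,
  env_scoped E -> nth_error E n = Some (phi, l) ->
  item_all (closed_at (length E - S n)) phi.
Proof.
  induction E as [|[psi l'] E IH]; intros [|n] phi l HE Hn; simpl in *; try discriminate.
  - inversion Hn; subst. rewrite Nat.sub_0_r. tauto.
  - eapply IH; eauto. tauto.
Qed.

Lemma stack_all_shift (K : Type) k (p : stack (term K)) :
  stack_all (closed_at k) p -> stack_all (closed_at (S k)) (map_stack (ren S) p).
Proof.
  intros H. eapply item_stack_all_map; [intros; apply iff_refl|].
  eapply item_stack_all_impl; [|exact H]. intros c Hc. apply closed_at_shift, Hc.
Qed.

Lemma scoped_nstep (K : Type) l (m m' : nstate K) : nstep l m m' -> scoped m -> scoped m'.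
Proof.
  unfold scoped.
  destruct 1; simpl; intros (HD & Ht & Hp & HE);
    try match type of HD with dump_all _ (_ :: _) => inversion HD; subst; simpl in * end;
    intuition.
  - constructor; auto.
  - unfold dump_all, map_dump in *. rewrite Forall_map.
    eapply Forall_impl; [|exact HD]. simpl. intros a [].
    split; [apply closed_at_shift | apply stack_all_shift]; auto.
  - apply stack_all_shift; auto.
  - eapply closed_at_ren; [|exact (env_scoped_nth _ _ HE H)].
    assert (n < length E) by (apply nth_error_Some; congruence).
    intros; lia.
Qed.

(** ** Unfoldings of the items *)

(** A [tagV] item is a code that is no explicit substitution, hence can serve as the [u] of [ue]
    with an empty [L]. *)
Definition item_ok (K : Type) (s : nat -> term K) (phi : item (term K)) (l : tag) : Prop :=
  match l with
  | tagV => exists u, phi = ICode u /\ ~ is_es u /\ value (usub s u)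
  | tagA => inert (usub s (decode_item phi))
  end.

Fixpoint stack_ok (K : Type) (s : nat -> term K) (p : stack (term K)) : Prop :=
  match p with
  | SNil => True
  | SCons phi l p => item_ok s phi l /\ stack_ok s p
  end.

Fixpoint env_sub (K : Type) (E : list (item (term K) * tag)) : nat -> term K :=
  match E with
  | [] => Var
  | (phi, _) :: E => scons (usub (env_sub E) (decode_item phi)) (env_sub E)
  end.

Fixpoint env_ok (K : Type) (E : list (item (term K) * tag)) : Prop :=
  match E with
  | [] => True
  | (phi, l) :: E => item_ok (env_sub E) phi l /\ env_ok E
  end.

Definition state_ok (K : Type) (m : nstate K) : Prop :=
  let s := env_sub (nst_env m) in
  Forall (fun c => stack_ok s (snd c)) (nst_dump m) /\ stack_ok s (nst_stack m) /\
  env_ok (nst_env m).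

Lemma item_ok_fireball (K : Type) s (phi : item (term K)) l :
  item_ok s phi l -> fireball (usub s (decode_item phi)).
Proof.
  destruct l; simpl.
  - intros (u & -> & _ & V). apply fireball_value, V.
  - apply fireball_inert.
Qed.

(** Justifies the label of the pairs built by [c3] and [c4]: an inert head applied to fireballs
    remains inert. *)
Lemma stack_ok_inert (K : Type) s (p : stack (term K)) : forall t,
  stack_ok s p -> inert (usub s t) -> inert (usub s (decode_stack p t)).
Proof.
  induction p as [|phi l p IH]; simpl; auto; intros t [Hi Hp] Ht. apply IH; auto.
  rewrite usub_app, inert_app_iff. split; auto. eapply item_ok_fireball; eauto.
Qed.

Lemma decode_ren (K : Type) (r : nat -> nat) :
  (forall phi : item (term K), decode_item (map_item (ren r) phi) = ren r (decode_item phi)) /\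
  (forall (p : stack (term K)) t,
     decode_stack (map_stack (ren r) p) (ren r t) = ren r (decode_stack p t)).
Proof.
  apply item_stack_ind; simpl; auto. intros phi H l p IH t. rewrite H.
  apply (IH (App t (decode_item phi))).
Qed.

Lemma item_ok_shift (K : Type) s a (phi : item (term K)) l :
  item_ok s phi l -> item_ok (scons a s) (map_item (ren S) phi) l.
Proof.
  destruct l; simpl.
  - intros (u & -> & N & V). exists (ren S u). rewrite usub_shift. repeat split; auto.
    intros (t & w & H). destruct u; try discriminate. apply N. do 2 eexists; reflexivity.
  - rewrite (proj1 (decode_ren K S)), usub_shift. auto.
Qed.

Lemma stack_ok_shift (K : Type) s a (p : stack (term K)) :
  stack_ok s p -> stack_ok (scons a s) (map_stack (ren S) p).
Proof. induction p; simpl; intuition auto using item_ok_shift. Qed.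

Lemma env_ok_nth (K : Type) (E : list (item (term K) * tag)) : forall n phi l,
  env_ok E -> nth_error E n = Some (phi, l) ->
  match l with
  | tagV => value (env_sub E n) /\ exists u, phi = ICode u /\ ~ is_es u
  | tagA => inert (env_sub E n)
  end.
Proof.
  induction E as [|[psi l'] E IH]; intros [|n] phi l HE Hn; simpl in *; try discriminate.
  - inversion Hn; subst. destruct l; simpl in HE; [|tauto].
    destruct HE as [(u & -> & N & V) _]. eauto.
  - apply (IH n phi l); tauto.
Qed.

Lemma state_ok_nstep (K : Type) l (m m' : nstate K) :
  nstep l m m' -> state_ok m -> state_ok m'.
Proof.
  unfold state_ok. destruct 1; simpl; intros (HD & Hp & HE);
    try match type of HD with Forall _ (_ :: _) => inversion HD; subst; simpl in * end;
    intuition.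
  - unfold map_dump. rewrite Forall_map. eapply Forall_impl; [|exact HD].
    simpl. intros a. apply stack_ok_shift.
  - apply stack_ok_shift; auto.
  - exists (Lam u). split; auto. split; [intros (? & ? & ?); discriminate|].
    eexists; reflexivity.
  - apply stack_ok_inert; auto. constructor.
  - apply stack_ok_inert; auto. exact (env_ok_nth _ _ HE H).
  - exists (Var n). split; auto. split; [intros (? & ? & ?); discriminate|].
    exact (proj1 (env_ok_nth _ _ HE H)).
Qed.

(** ** Simulation *)

Definition ndecode (K : Type) (m : nstate K) : term K :=
  decode_env (nst_env m) (decode_dump (nst_dump m) (decode_stack (nst_stack m) (nst_term m))).

Fixpoint stack_ctx (K : Type) (p : stack (term K)) (C : sctx K) : sctx K :=
  match p with
  | SNil => C
  | SCons phi _ p => stack_ctx p (SAppL C (decode_item phi))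
  end.

Fixpoint dump_ctx (K : Type) (D : dump (term K)) (C : sctx K) : sctx K :=
  match D with
  | [] => C
  | (u, p) :: D => dump_ctx D (stack_ctx p (SAppR u C))
  end.

Fixpoint env_ctx (K : Type) (E : list (item (term K) * tag)) (C : sctx K) : sctx K :=
  match E with
  | [] => C
  | (phi, _) :: E => env_ctx E (SEs C (decode_item phi))
  end.

Lemma plug_stack_ctx (K : Type) (p : stack (term K)) t : forall C,
  plug (stack_ctx p C) t = decode_stack p (plug C t).
Proof. induction p; simpl; intros; [|rewrite IHp]; reflexivity. Qed.

Lemma plug_dump_ctx (K : Type) (D : dump (term K)) t : forall C,
  plug (dump_ctx D C) t = decode_dump D (plug C t).
Proof.
  induction D as [|[u p] D IH]; simpl; intros; [|rewrite IH, plug_stack_ctx]; reflexivity.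
Qed.

Lemma plug_env_ctx (K : Type) (E : list (item (term K) * tag)) t : forall C,
  plug (env_ctx E C) t = decode_env E (plug C t).
Proof. induction E as [|[phi l] E IH]; simpl; intros; [|rewrite IH]; reflexivity. Qed.

Lemma comp_stack_ctx (K : Type) (p : stack (term K)) C' : forall C,
  comp (stack_ctx p C) C' = stack_ctx p (comp C C').
Proof. induction p; simpl; intros; [|rewrite IHp]; reflexivity. Qed.

Lemma comp_dump_ctx (K : Type) (D : dump (term K)) C' : forall C,
  comp (dump_ctx D C) C' = dump_ctx D (comp C C').
Proof.
  induction D as [|[u p] D IH]; simpl; intros; [|rewrite IH, comp_stack_ctx]; reflexivity.
Qed.

Lemma comp_env_ctx (K : Type) (E : list (item (term K) * tag)) C' : forall C,
  comp (env_ctx E C) C' = env_ctx E (comp C C').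
Proof. induction E as [|[phi l] E IH]; simpl; intros; [|rewrite IH]; reflexivity. Qed.

Lemma depth_stack_ctx (K : Type) (p : stack (term K)) : forall C,
  depth (stack_ctx p C) = depth C.
Proof. induction p; simpl; intros; [|rewrite IHp]; reflexivity. Qed.

Lemma depth_dump_ctx (K : Type) (D : dump (term K)) : forall C,
  depth (dump_ctx D C) = depth C.
Proof.
  induction D as [|[u p] D IH]; simpl; intros; [|rewrite IH, depth_stack_ctx]; reflexivity.
Qed.

Lemma depth_env_ctx (K : Type) (E : list (item (term K) * tag)) : forall C,
  depth (env_ctx E C) = length E + depth C.
Proof. induction E as [|[phi l] E IH]; simpl; intros; auto. rewrite IH. simpl. lia. Qed.

Lemma env_ctx_app (K : Type) (E1 E2 : list (item (term K) * tag)) : forall C,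
  env_ctx (E1 ++ E2) C = env_ctx E2 (env_ctx E1 C).
Proof. induction E1 as [|[phi l] E IH]; simpl; intros; auto. Qed.

Lemma decode_env_app (K : Type) (E1 E2 : list (item (term K) * tag)) : forall t,
  decode_env (E1 ++ E2) t = decode_env E2 (decode_env E1 t).
Proof. induction E1 as [|[phi l] E IH]; simpl; intros; auto. Qed.

(** The flag reaching [C] is [true] below a nonempty stack and inherited otherwise, hence the
    quantification over [b]. *)
Lemma ev_stack_ctx (K : Type) s (p : stack (term K)) : forall C,
  stack_ok s p -> (forall b, ev b s C) -> forall b, ev b s (stack_ctx p C).
Proof.
  induction p as [|phi l p IH]; simpl; auto. intros C [Hi Hp] H.
  apply IH; simpl; auto. intros _. split; auto. eapply item_ok_fireball; eauto.
Qed.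

Lemma ev_dump_ctx (K : Type) s (D : dump (term K)) : forall C,
  Forall (fun c => stack_ok s (snd c)) D ->
  (forall b, ev b s C) -> forall b, ev b s (dump_ctx D C).
Proof.
  induction D as [|[u p] D IH]; simpl; auto. intros C HD H. inversion HD; subst.
  apply IH; auto. apply ev_stack_ctx; simpl; auto.
Qed.

Lemma ev_env_ctx (K : Type) (E : list (item (term K) * tag)) b : forall C,
  env_ok E -> ev b (env_sub E) C -> ev b Var (env_ctx E C).
Proof.
  induction E as [|[phi l] E IH]; simpl; auto. intros C [Hi HE] H.
  apply IH; auto. simpl. split; auto. eapply item_ok_fireball; eauto.
Qed.

(** The first stack item makes the context applicative; both principal transitions require a
    nonempty stack. *)
Lemma useful_state_ctx (K : Type) D phi l (p : stack (term K)) E :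
  Forall (fun c => stack_ok (env_sub E) (snd c)) D ->
  stack_ok (env_sub E) (SCons phi l p) -> env_ok E ->
  useful (env_ctx E (dump_ctx D (stack_ctx (SCons phi l p) SHole))).
Proof.
  intros HD [Hi Hp] HE. apply useful_iff, ev_env_ctx; auto.
  apply ev_dump_ctx; auto. simpl. apply ev_stack_ctx; auto.
  intros b. simpl. split; auto. eapply item_ok_fireball; eauto.
Qed.

Lemma decode_stack_equiv (K : Type) (p : stack (term K)) : forall t t',
  equiv t t' -> equiv (decode_stack p t) (decode_stack p t').
Proof. induction p; simpl; auto using equiv_appl. Qed.

Lemma decode_dump_equiv (K : Type) (D : dump (term K)) : forall t t',
  equiv t t' -> equiv (decode_dump D t) (decode_dump D t').
Proof.
  induction D as [|[u p] D IH]; simpl; auto using decode_stack_equiv, equiv_appr.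
Qed.

Lemma decode_env_equiv (K : Type) (E : list (item (term K) * tag)) : forall t t',
  equiv t t' -> equiv (decode_env E t) (decode_env E t').
Proof. induction E as [|[phi l] E IH]; simpl; auto using equiv_esl. Qed.

(** The substitution created by [um] arises below stack and dump, whereas the machine stores it in
    the environment; the application axioms float it out, and their shifts are those of
    [nstep_um]. *)
Lemma decode_stack_es (K : Type) (p : stack (term K)) u : forall t,
  equiv (decode_stack p (Es t u)) (Es (decode_stack (map_stack (ren S) p) t) u).
Proof.
  induction p as [|phi l p IH]; simpl; intros t; [apply equiv_refl|].
  rewrite (proj1 (decode_ren K S)). eapply equiv_trans; [|apply IH].
  apply decode_stack_equiv, equiv_sym, equiv_in_ax, ax_appl.
Qed.

Lemma decode_dump_es (K : Type) (D : dump (term K)) u : forall t,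
  equiv (decode_dump D (Es t u)) (Es (decode_dump (map_dump (ren S) D) t) u).
Proof.
  induction D as [|[w p] D IH]; simpl; intros t; [apply equiv_refl|].
  eapply equiv_trans; [|apply IH]. apply decode_dump_equiv.
  eapply equiv_trans; [|apply decode_stack_es].
  apply decode_stack_equiv, equiv_sym, equiv_in_ax, ax_appr.
Qed.

Lemma ndecode_commutative (K : Type) l (m m' : nstate K) :
  nstep l m m' -> gkind l = None -> ndecode m = ndecode m'.
Proof. destruct 1; intros ?; try discriminate; reflexivity. Qed.

Lemma ndecode_um (K : Type) (m m' : nstate K) :
  nstep lum m m' -> state_ok m -> exists u, um (ndecode m) u /\ equiv u (ndecode m').
Proof.
  intros H (HD & Hp & HE). inversion H; subst. unfold ndecode. simpl in *.
  exists (decode_env E (decode_dump D (decode_stack p (Es t (decode_item phi))))). split.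
  - assert (U := @useful_state_ctx _ D phi l p E HD Hp HE). simpl in U.
    set (C := env_ctx E (dump_ctx D (stack_ctx p SHole))).
    replace (env_ctx _ _) with (comp C (SAppL LHole (decode_item phi))) in U
      by (unfold C; rewrite comp_env_ctx, comp_dump_ctx, comp_stack_ctx; reflexivity).
    assert (P : forall w, decode_env E (decode_dump D (decode_stack p w)) = plug C w)
      by (intros w; unfold C; rewrite plug_env_ctx, plug_dump_ctx, plug_stack_ctx; reflexivity).
    rewrite !P. assert (R := um_step C LHole t _ U). simpl in R.
    rewrite ren_id in R by reflexivity. exact R.
  - apply decode_env_equiv.
    eapply equiv_trans; [apply decode_dump_equiv, decode_stack_es | apply decode_dump_es].
Qed.

Lemma unfold_in_env_ctx (K : Type) (E : list (item (term K) * tag)) t : forall C,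
  unfold_in t (env_ctx E C) = sub (env_sub E) (unfold_in t C).
Proof.
  induction E as [|[phi l] E IH]; simpl; intros C.
  - symmetry. apply sub_id. reflexivity.
  - rewrite IH. apply sub_sub_single.
Qed.

Lemma env_sub_app (K : Type) (E1 E2 : list (item (term K) * tag)) n :
  env_sub (E1 ++ E2) (length E1 + n) = env_sub E2 n.
Proof. induction E1 as [|[phi l] E IH]; simpl; auto. Qed.

Lemma ndecode_ue (K : Type) (m m' : nstate K) :
  nstep lue m m' -> state_ok m -> ue (ndecode m) (ndecode m').
Proof.
  intros H (HD & Hp & HE). inversion H; subst. unfold ndecode. simpl in *.
  destruct (env_ok_nth _ _ HE H0) as (V & u' & Hu & N). inversion Hu; subst u'.
  assert (U := @useful_state_ctx _ D phi l p E HD Hp HE).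
  destruct (nth_error_split _ _ H0) as (E1 & E2 & -> & Hn).
  (* [C] spans from the hole to the entry of the variable; only the [n] entries of [E1] bind in it,
     so its depth is the index [n]. *)
  set (C := env_ctx E1 (dump_ctx D (stack_ctx (SCons phi l p) SHole))).
  assert (P : forall w, decode_env (E1 ++ (ICode u, tagV) :: E2)
      (decode_dump D (decode_stack p (App w (decode_item phi)))) =
      plug (env_ctx E2 SHole) (Es (plug C w) u)).
  { intros w. unfold C.
    rewrite decode_env_app, !plug_env_ctx, plug_dump_ctx, plug_stack_ctx. reflexivity. }
  assert (HC : depth C = n).
  { unfold C. rewrite depth_env_ctx, depth_dump_ctx, depth_stack_ctx. simpl. lia. }
  rewrite !P, <- HC.
  assert (R : ue (plug (env_ctx E2 SHole) (Es (plug C (Var (depth C))) (plug LHole u)))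
    (plug (env_ctx E2 SHole) (plug LHole (Es (plug (ren_ctx (upr (Nat.add 0)) C)
                    (ren (Nat.add (S (depth C))) u)) u)))).
  { apply (ue_step (env_ctx E2 SHole) C LHole); auto.
    - rewrite comp_env_ctx. rewrite env_ctx_app in U. exact U.
    - rewrite comp_env_ctx, unfold_in_env_ctx. simpl.
      rewrite <- (Nat.add_0_r n), <- Hn, env_sub_app in V. exact V. }
  rewrite ren_ctx_id in R by (intros [|]; reflexivity). exact R.
Qed.

(** ** Progress *)

Lemma usub_decode_env (K : Type) (E : list (item (term K) * tag)) : forall t,
  usub Var (decode_env E t) = usub (env_sub E) t.
Proof. induction E as [|[phi l] E IH]; simpl; intros t; auto. rewrite IH. apply usub_es. Qed.

(** A state can only be stuck with an empty dump: either at a value with an empty stack, or at an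
    inert head facing a stack of fireballs. *)
Lemma progress_or_fireball (K : Type) (m : nstate K) :
  scoped m -> state_ok m -> lambda_term (nst_term m) ->
  (exists l m', nstep l m m') \/ fireball (usub Var (ndecode m)).
Proof.
  destruct m as [D t p E]. intros (_ & Ht & _ & _) (HD & Hp & HE) L.
  unfold ndecode. simpl in *. rewrite usub_decode_env.
  destruct t as [n|a|t|t u|t u]; simpl in *.
  - destruct (nth_error E n) as [[phi l]|] eqn:Hn;
      [|apply nth_error_None in Hn; lia].
    assert (H := env_ok_nth _ _ HE Hn). destruct l.
    + destruct H as (V & u & -> & _). destruct p as [|psi l p].
      * destruct D as [|[t p] D].
        -- right. apply fireball_value, V.
        -- left. do 2 eexists. eapply nstep_c5; eauto.
      * left. do 2 eexists. eapply nstep_ue; eauto.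
    + destruct D as [|[t p0] D].
      * right. apply fireball_inert, stack_ok_inert; auto.
      * left. do 2 eexists. eapply nstep_c4; eauto.
  - destruct D as [|[t p0] D].
    + right. apply fireball_inert, stack_ok_inert; auto. constructor.
    + left. do 2 eexists. apply nstep_c3.
  - destruct p as [|psi l p].
    + destruct D as [|[u p] D].
      * right. apply fireball_value. eexists; reflexivity.
      * left. do 2 eexists. apply nstep_c2.
    + left. do 2 eexists. apply nstep_um.
  - left. do 2 eexists. apply nstep_c1.
  - destruct L.
Qed.

(** * Names *)

Lemma index_lt_iff (G : list name) x : index x G < length G <-> In x G.
Proof.
  induction G as [|y G IH]; simpl; [lia|].
  destruct (Nat.eqb_spec x y); subst; [intuition lia|].
  rewrite <- Nat.succ_lt_mono, IH. intuition congruence.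
Qed.

Lemma index_app (G1 G2 : list name) x :
  ~ In x G1 -> index x (G1 ++ G2) = length G1 + index x G2.
Proof.
  induction G1 as [|y G IH]; simpl; intros H; auto.
  destruct (Nat.eqb_spec x y); subst; [tauto|]. rewrite IH; tauto.
Qed.

Lemma index_cons_neq (G : list name) x y : x <> y -> index x (y :: G) = S (index x G).
Proof. intros H. simpl. destruct (Nat.eqb_spec x y); tauto. Qed.

Lemma index_nth (G : list name) : forall n d, NoDup G -> n < length G ->
  index (nth n G d) G = n.
Proof.
  induction G as [|y G IH]; simpl; intros n d N H; [lia|].
  inversion N; subst. destruct n as [|n]; [rewrite Nat.eqb_refl; auto|].
  destruct (Nat.eqb_spec (nth n G d) y) as [E|].
  - destruct H2. rewrite <- E. apply nth_In. lia.
  - rewrite IH; auto. lia.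
Qed.

(** The bound [k] restricts the comparison of scopes to names that can occur; dangling indices need
    not agree. *)
Lemma nameless_ren (K : Type) (t : code K) : forall k G G' r,
  closed_at k (nameless G t) ->
  (forall z, index z G < k -> index z G' = r (index z G)) ->
  nameless G' t = ren r (nameless G t).
Proof.
  induction t as [x|a|x t IH|t1 IH1 t2 IH2]; simpl; intros k G G' r Hk H.
  - rewrite H; auto.
  - reflexivity.
  - f_equal. apply (IH (S k)); auto. intros z. simpl.
    destruct (Nat.eqb z x); simpl; auto. intros Hz. rewrite H; auto. lia.
  - f_equal; [eapply IH1 | eapply IH2]; eauto; tauto.
Qed.

Lemma closed_at_mono (K : Type) (t : term K) : forall k k',
  k <= k' -> closed_at k t -> closed_at k' t.
Proof.
  intros k k' Hk Ht. rewrite <- (@ren_id _ t (fun n => n)) by auto.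
  apply (closed_at_ren _ (k := k)); auto. intros; lia.
Qed.

Lemma closed_at_exists (K : Type) (t : term K) : exists k, closed_at k t.
Proof.
  induction t as [n|a|t [k IH]|t [k1 IH1] u [k2 IH2]|t [k1 IH1] u [k2 IH2]]; simpl.
  - exists (S n). lia.
  - exists 0; auto.
  - exists k. apply (closed_at_mono _ (Nat.le_succ_diag_r k)), IH.
  - exists (max k1 k2). split; [apply (@closed_at_mono _ _ k1) | apply (@closed_at_mono _ _ k2)]; auto; lia.
  - exists (max k1 k2). split; [apply (@closed_at_mono _ _ k1) | apply (@closed_at_mono _ _ k2)]; auto; lia.
Qed.

Lemma code_alpha_nameless (K : Type) (t u : code K) G :
  code_alpha t u -> nameless G t = nameless G u.
Proof.
  intros H. destruct (closed_at_exists (nameless [] t)) as [k Hk].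
  (* In the empty scope a free name is its own index, so this renaming reads it again in [G]. *)
  transitivity (ren (fun n => index n G) (nameless [] t)).
  - eapply nameless_ren; eauto.
  - rewrite H in *. symmetry. eapply nameless_ren; eauto.
Qed.

Lemma lambda_nameless (K : Type) (t : code K) : forall G, lambda_term (nameless G t).
Proof. induction t; simpl; auto. Qed.

(** ** Fresh names *)

Fixpoint lambdas (K : Type) (t : term K) : nat :=
  match t with
  | Lam t => S (lambdas t)
  | App t u => lambdas t + lambdas u
  | _ => 0
  end.

(** Junk value on explicit substitutions. *)
Fixpoint named (K : Type) (k : nat) (G : list name) (t : term K) : code K :=
  match t with
  | Var n => CVar (nth n G (n - length G))
  | Cst a => CCst a
  | Lam t => CLam k (named (S k) (k :: G) t)
  | App t u => CApp (named k G t) (named (k + lambdas t) G u)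
  | Es t _ => named k G t
  end.

(** Free names lie below [k0] and binder names at or above it, which prevents capture. The default
    [n - length G] of [nth] inverts the dangling index [length G + x]. *)
Lemma nameless_named (K : Type) (t : term K) : forall k0 k G,
  lambda_term t -> closed_at (length G + k0) t -> NoDup G -> k0 <= k ->
  (forall z, In z G -> k0 <= z < k) -> nameless G (named k G t) = t.
Proof.
  induction t as [n|a|t IH|t IHt u IHu|t IHt u IHu]; intros k0 k G L C N Hk H;
    simpl in *; try tauto.
  - f_equal. destruct (Nat.lt_ge_cases n (length G)) as [Hn|Hn].
    + apply index_nth; auto.
    + rewrite nth_overflow by auto.
      assert (A := @index_app G [] (n - length G)). rewrite app_nil_r in A.
      etransitivity; [apply A | simpl; unfold name in *; lia].
      intros I. specialize (H _ I). lia.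
  - f_equal. apply (IH k0); auto.
    + constructor; auto. intros I. specialize (H _ I). lia.
    + intros z [<-|I]; [lia|]. specialize (H _ I). lia.
  - destruct L, C. f_equal; [apply (IHt k0) | apply (IHu k0)]; auto; [lia|].
    intros z I. specialize (H _ I). lia.
Qed.

Lemma binders_named (K : Type) (t : term K) : forall k G, lambda_term t ->
  NoDup (binders (named k G t)) /\
  forall x, In x (binders (named k G t)) -> k <= x < k + lambdas t.
Proof.
  induction t as [n|a|t IH|t IHt u IHu|t IHt u IHu]; intros k G L; simpl in *;
    try (split; [constructor | intros _ []]).
  - destruct (IH (S k) (k :: G) L) as [N H]. split.
    + constructor; auto. intros I. specialize (H _ I). lia.
    + intros x [<-|I]; [lia|]. specialize (H _ I). lia.
  - destruct L as [Lt Lu]. destruct (IHt k G Lt) as [Nt Ht].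
    destruct (IHu (k + lambdas t) G Lu) as [Nu Hu]. split.
    + apply NoDup_app; auto. intros x I J.
      specialize (Ht _ I). specialize (Hu _ J). lia.
    + intros x I. apply in_app_or in I. destruct I as [I|I];
        [specialize (Ht _ I) | specialize (Hu _ I)]; lia.
  - tauto.
Qed.

Lemma fresh_code (K : Type) (t : term K) k : lambda_term t ->
  exists c, nameless [] c = t /\ NoDup (binders c) /\
    forall x, In x (binders c) -> k <= x.
Proof.
  intros L. destruct (closed_at_exists t) as [k0 C].
  exists (named (max k k0) [] t).
  destruct (binders_named t (max k k0) [] L) as [N H]. repeat split; auto.
  - apply (nameless_named _ (k0 := k0)); auto; [constructor | lia | intros _ []].
  - intros x I. specialize (H _ I). lia.
Qed.

(** ** The named machine and the nameless one *)

Lemma length_nameless_env (K : Type) (E : env K) : length (nameless_env E) = length (dom E).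
Proof. induction E as [|[x [phi l]] E IH]; simpl; auto. Qed.

Lemma bound_to_nth (K : Type) (E : env K) x phi l : bound_to E x phi l ->
  exists E1 E2, E = E1 ++ (x, (phi, l)) :: E2 /\ index x (dom E) = length E1 /\
    nth_error (nameless_env E) (index x (dom E)) =
    Some (map_item (nameless (dom E2)) phi, l).
Proof.
  intros (E1 & E2 & -> & H). exists E1, E2. split; auto.
  assert (I : index x (dom (E1 ++ (x, (phi, l)) :: E2)) = length E1).
  { unfold dom in *. rewrite map_app, index_app by auto. simpl.
    rewrite Nat.eqb_refl, length_map. lia. }
  split; auto. rewrite I. clear. induction E1 as [|[y [psi l']] E IH]; simpl; auto.
Qed.

Lemma nth_bound_to (K : Type) (E : env K) x : forall psi l,
  nth_error (nameless_env E) (index x (dom E)) = Some (psi, l) ->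
  exists phi G, bound_to E x phi l /\ psi = map_item (nameless G) phi.
Proof.
  induction E as [|[y [phi' l']] E IH]; simpl; intros psi l H.
  - destruct x; discriminate.
  - destruct (Nat.eqb_spec x y) as [->|Hxy]; simpl in H.
    + inversion H; subst. exists phi', (dom E). split; auto.
      exists [], E. simpl; auto.
    + destruct (IH _ _ H) as (phi & G & (E1 & E2 & -> & HE) & ->).
      exists phi, G. split; auto. exists ((y, (phi', l')) :: E1), E2. split; auto.
      simpl. intros [?|?]; [congruence | tauto].
Qed.

Lemma bound_to_functional (K : Type) (E : env K) x phi l phi' l' :
  bound_to E x phi l -> bound_to E x phi' l' -> phi = phi' /\ l = l'.
Proof.
  intros (E1 & E2 & -> & H) (F1 & F2 & HE & H').
  revert F1 HE H'. induction E1 as [|[y b] E1 IH]; intros [|[z c] F1] HE H';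
    simpl in *; inversion HE; subst; simpl in *; try tauto.
  apply (IH (fun I => H (or_intror I)) F1); auto.
Qed.

Definition env_binders (K : Type) (E : env K) : list name :=
  flat_map (fun b => fst b :: item_binders (fst (snd b))) E.

Lemma dom_env_binders (K : Type) (E : env K) x : In x (dom E) -> In x (env_binders E).
Proof.
  induction E as [|b E IH]; simpl; auto. rewrite in_app_iff. tauto.
Qed.

Lemma NoDup_dom (K : Type) (E : env K) : NoDup (env_binders E) -> NoDup (dom E).
Proof.
  induction E as [|[x [phi l]] E IH]; simpl; intros H; constructor.
  - inversion H; subst. intros I. apply H2, in_or_app. auto using dom_env_binders.
  - inversion H; subst. eauto using NoDup_app_remove_l.
Qed.

Lemma well_named_dom (K : Type) (s : gstate K) : well_named s -> NoDup (dom (st_env s)).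
Proof.
  intros H. apply NoDup_dom. unfold well_named, state_binders in H.
  do 3 apply NoDup_app_remove_l in H. exact H.
Qed.

(** Well-naming enters twice. In [um] the new name is not in the environment, so enlarging the scope
    acts as [S] on scoped codes. In [ue] the names visible to the entry are not rebound at or in
    front of it, so changing scope is the shift of [nstep_ue]. *)
Lemma gstep_nstep (K : Type) l (s s' : gstate K) :
  well_named s -> scoped (nameless_state s) -> gstep l s s' ->
  nstep l (nameless_state s) (nameless_state s').
Proof.
  intros W (HD & Ht & Hp & HE) H. destruct H; unfold nameless_state; simpl in *;
    try (constructor; fail).
  - assert (Hx : ~ In x (dom E)).
    { intros I. unfold well_named, state_binders in W. simpl in W.
      apply NoDup_app_remove_l in W. inversion W; subst.
      apply H1. rewrite !in_app_iff. right. right. apply (dom_env_binders E), I. }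
    assert (Hs : forall c : code K, closed_at (length (nameless_env E)) (nameless (dom E) c) ->
              nameless (x :: dom E) c = ren S (nameless (dom E) c)).
    { intros c Hc. eapply nameless_ren; [exact Hc|]. intros z Hz.
      apply index_cons_neq. rewrite length_nameless_env, index_lt_iff in Hz. congruence. }
    destruct Hp as [_ Hp].
    replace (map_dump (nameless (x :: dom E)) D)
      with (map_dump (ren S) (map_dump (nameless (dom E)) D)).
    replace (map_stack (nameless (x :: dom E)) p)
      with (map_stack (ren S) (map_stack (nameless (dom E)) p)).
    + apply nstep_um.
    + rewrite (proj2 (map_item_stack_map _ _)). symmetry.
      eapply map_item_stack_ext; [exact Hs|].
      eapply item_stack_all_map; [|exact Hp]. reflexivity.
    + unfold map_dump, dump_all in *. rewrite map_map. rewrite Forall_map in HD.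
      apply map_ext_Forall. eapply Forall_impl; [|exact HD]. simpl. intros [c p0] [Hc Hp0].
      simpl in *. rewrite Hs by auto. f_equal.
      rewrite (proj2 (map_item_stack_map _ _)). symmetry.
      eapply map_item_stack_ext; [exact Hs|].
      eapply item_stack_all_map; [|exact Hp0]. reflexivity.
  - destruct (bound_to_nth H) as (E1 & E2 & _ & _ & Hn). eapply nstep_c4, Hn.
  - destruct (bound_to_nth H) as (E1 & E2 & _ & _ & Hn). eapply nstep_c5, Hn.
  - destruct (bound_to_nth H) as (E1 & E2 & HE12 & Hi & Hn). simpl in Hn.
    assert (N := well_named_dom W). simpl in N.
    assert (Hc := env_scoped_nth _ _ HE Hn). simpl in Hc.
    rewrite <- (code_alpha_nameless (dom E) H0).
    replace (nameless (dom E) u)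
      with (ren (Nat.add (S (index x (dom E)))) (nameless (dom E2) u)).
    + apply nstep_ue, Hn.
    + symmetry. eapply nameless_ren; [exact Hc|]. intros z Hz. rewrite Hi in *.
      subst E. rewrite length_nameless_env in Hz. unfold dom in *.
      rewrite map_app in *. simpl in *. rewrite length_app, length_map in Hz. simpl in Hz.
      assert (Iz : In z (map fst E2)) by (apply index_lt_iff; lia).
      rewrite index_app, index_cons_neq, length_map; [lia | |].
      * intros ->. apply NoDup_remove_2 in N. apply N, in_or_app. auto.
      * intros Iz'. apply in_split in Iz'. destruct Iz' as (F1 & F2 & Q).
        rewrite Q, <- app_assoc in N. apply NoDup_remove_2 in N.
        apply N. rewrite !in_app_iff. simpl. auto.
Qed.

(** Commutative and multiplicative transitions only permute the binders of the state; [ue] has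
    well-naming of its target as a premise. *)
Lemma well_named_gstep (K : Type) l (s s' : gstate K) :
  gstep l s s' -> well_named s -> well_named s'.
Proof.
  intros H. destruct H; auto; unfold well_named, state_binders; simpl;
    apply Permutation_NoDup, (Permutation_count_occ Nat.eq_dec); intros z;
    repeat (rewrite ?count_occ_app; simpl);
    try match goal with |- context [Nat.eq_dec ?a ?b] => destruct (Nat.eq_dec a b) end; lia.
Qed.

Lemma in_list_max (l : list nat) x : In x l -> x <= list_max l.
Proof.
  intros I. assert (F := proj1 (list_max_le l _) (Nat.le_refl _)).
  rewrite Forall_forall in F. auto.
Qed.

Lemma fresh_alpha (K : Type) D (x : name) (p : stack (code K)) E u :
  well_named (St D (CVar x) p E) ->
  exists u', code_alpha u u' /\ well_named (St D u' p E).
Proof.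
  unfold well_named, state_binders. simpl.
  set (l1 := flat_map _ D). set (l2 := stack_binders p ++ _). intros W.
  destruct (fresh_code (nameless [] u) (S (list_max (l1 ++ l2))) (lambda_nameless u []))
    as (u' & Hu & N & F).
  exists u'. split; [symmetry; exact Hu|].
  apply (Permutation_NoDup (l := binders u' ++ l1 ++ l2)).
  - rewrite !app_assoc. apply Permutation_app_tail, Permutation_app_comm.
  - apply NoDup_app; auto. intros y I J. specialize (F _ I). apply in_list_max in J. lia.
Qed.

Lemma nstep_gstep (K : Type) l (s : gstate K) m :
  well_named s -> nstep l (nameless_state s) m -> exists s', gstep l s s'.
Proof.
  intros W H. destruct s as [D t p E]. unfold nameless_state in H. simpl in H.
  destruct t; simpl in H; inversion H; subst;
    try match goal with H : _ = map_dump _ ?D |- _ =>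
      destruct D as [|[? ?] ?]; simpl in H; inversion H; subst; clear H end;
    try match goal with H : _ = map_stack _ ?p |- _ =>
      destruct p; simpl in H; inversion H; subst; clear H end;
    try match goal with H : nth_error _ _ = _ |- _ =>
      apply nth_bound_to in H; destruct H as (psi0 & G & B & HG) end;
    try (eexists; constructor; fail).
  - eexists. eapply step_c4, B.
  - destruct psi0; inversion HG. eexists. eapply step_c5, B.
  - destruct psi0 as [u0|]; inversion HG.
    destruct (fresh_alpha u0 W) as (u' & A & W').
    eexists. eapply step_ue; eauto.
Qed.

(** * The distillery *)

Lemma reachable_invariant (K : Type) (s : gstate K) : reachable (glamour K) s ->
  well_named s /\ scoped (nameless_state s) /\ state_ok (nameless_state s).
Proof.
  induction 1 as [s (t & -> & N & C) | l s s' _ (W & Sc & Ok) H].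
  - split; [|split].
    + unfold well_named, state_binders. simpl. rewrite app_nil_r. exact N.
    + repeat split; auto. constructor.
    + repeat split. constructor.
  - simpl in H. assert (R := gstep_nstep W Sc H).
    split; [|split]; eauto using well_named_gstep, scoped_nstep, state_ok_nstep.
Qed.

Lemma gstep_deterministic (K : Type) l1 l2 (s s1 s2 : gstate K) :
  gstep l1 s s1 -> gstep l2 s s2 -> l1 = l2 /\ state_alpha s1 s2.
Proof.
  intros H1 H2. destruct H1; inversion H2; subst;
    repeat match goal with
    | B : bound_to ?E ?x _ _, B' : bound_to ?E ?x _ _ |- _ =>
        destruct (bound_to_functional B B') as [Q1 Q2]; clear B'; inversion Q1;
        inversion Q2; subst
    end;
    try (split; reflexivity).
  split; auto. unfold state_alpha, nameless_state. simpl. f_equal.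
  apply code_alpha_nameless. unfold code_alpha in *. congruence.
Qed.

Fixpoint code_size (K : Type) (t : code K) : nat :=
  match t with
  | CVar _ | CCst _ => 1
  | CLam _ t => S (code_size t)
  | CApp t u => S (code_size t + code_size u)
  end.

(** Measures the code still to be visited: commutative transitions split an application or move
    visited code to a stack, and stacks are not counted. *)
Definition state_size (K : Type) (s : gstate K) : nat :=
  list_sum (map (fun c => code_size (fst c)) (st_dump s)) + code_size (st_code s).

Lemma commutative_state_size (K : Type) l (s s' : gstate K) :
  gstep l s s' -> gkind l = None -> state_size s' < state_size s.
Proof.
  unfold state_size. destruct 1; intros ?; try discriminate; simpl; lia.
Qed.

Lemma glamour_explicit (K : Type) :
  explicit (glamour K) (@uf K) (@equiv K) (@decode K).
Proof.
  intros l r s s' Hs H Hk. destruct (reachable_invariant Hs) as (W & Sc & Ok).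
  assert (R := gstep_nstep W Sc H).
  destruct l; inversion Hk; subst.
  - exact (ndecode_um R Ok).
  - exists (decode s'). split; [exact (ndecode_ue R Ok) | apply equiv_refl].
Qed.

Lemma glamour_distillery (K : Type) :
  distillery (glamour K) (@uf K) (@equiv K) (@decode K).
Proof.
  constructor; simpl.
  - split; red; unfold state_alpha; congruence.
  - apply gstep_deterministic.
  - intros l s t s' Hs Ht Heq H.
    destruct (reachable_invariant Hs) as (Ws & Scs & _).
    destruct (reachable_invariant Ht) as (Wt & Sct & _).
    assert (R := gstep_nstep Ws Scs H). unfold state_alpha in Heq. rewrite Heq in R.
    destruct (nstep_gstep Wt R) as [t' H']. exists t'. split; auto.
    (* Both transitions project to steps with the same label from one nameless state, so their
       targets agree up to names. *)
    exact (nstep_deterministic R (gstep_nstep Wt Sct H')).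
  - intros s t H. unfold decode. rewrite H. reflexivity.
  - intros s (t & -> & N & C). split; [apply lambda_nameless | exact C].
  - intros s t (t1 & -> & _) (t2 & -> & _) H. unfold decode in H. simpl in H.
    unfold state_alpha, nameless_state. simpl. rewrite H. reflexivity.
  - intros t L C. destruct (fresh_code t 0 L) as (c & Hc & N & _).
    exists (St [] c SNil []). split; [|exact Hc]. exists c. rewrite Hc. auto.
  - intros r1 r2 t t1 t2 H1 H2.
    exact (redS_deterministic (uf_redS r1 _ _ H1) (uf_redS r2 _ _ H2)).
  - split; red; eauto using equiv_refl, equiv_sym, equiv_trans.
  - intros r t u t' G E H.
    destruct (proj1 (red_sim_equiv E) r false Var t') as (u' & R & Q);
      eauto using generated_fireball_es, uf_redS, redS_uf.
  - intros l r s s' Hs H Hk. destruct (glamour_explicit Hs H Hk) as (u & R & E). eauto.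
  - intros l s s' Hs H Hk. destruct (reachable_invariant Hs) as (W & Sc & _).
    apply equiv_refl_eq. exact (ndecode_commutative (gstep_nstep W Sc H) Hk).
Qed.

Lemma glamour_reflective (K : Type) : reflective (glamour K) (@uf K) (@decode K).
Proof.
  constructor.
  - intros s _. induction s as [s IH] using (well_founded_induction
      (Wf_nat.well_founded_ltof _ (@state_size K))).
    constructor. intros s' (l & Hk & H). apply IH.
    exact (commutative_state_size H Hk).
  - intros s Hs (r & u & H). destruct (reachable_invariant Hs) as (W & Sc & Ok).
    destruct (progress_or_fireball Sc Ok (lambda_nameless _ _)) as [(l & m & R) | F].
    + destruct (nstep_gstep W R) as [s' H']. exists l, s'. exact H'.
    + destruct (redS_not_fireball (uf_redS r _ _ H) F).
Qed.

Theorem theorem9 (K : Type) :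
  reflective_explicit_distillery (glamour K) (@uf K) (@equiv K) (@decode K)
  /\ (forall s : gstate K, reachable (glamour K) s ->
       (forall (l : glabel) (s' : gstate K),
          In l [c1; c2; c3; c4; c5] -> gstep l s s' -> decode s = decode s')
       /\ (forall s' : gstate K, gstep lum s s' ->
             exists u : term K, um (decode s) u /\ equiv u (decode s'))
       /\ (forall s' : gstate K, gstep lue s s' -> ue (decode s) (decode s'))).
Proof.
  split; [split; [|split];
    auto using glamour_distillery, glamour_reflective, glamour_explicit|].
  intros s Hs. destruct (reachable_invariant Hs) as (W & Sc & Ok). repeat split.
  - intros l s' Hl H. apply (ndecode_commutative (gstep_nstep W Sc H)).
    simpl in Hl. intuition (subst; auto).
  - intros s' H. exact (glamour_explicit Hs H eq_refl).
  - intros s' H. exact (ndecode_ue (gstep_nstep W Sc H) Ok).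
Qed.
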